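(* Fix an integer $s\ge 0$. For all integers $k\ge 0$ and $n\ge 1$ define $\hat\theta^{n,k,s}\in\mathbb{Q}V_{\mathrm{loopless}}^{n,k,s}$ by the following recursion: (i) $\hat\theta^{1,0,s}$ is the graph consisting of a single vertex with $s$ external edges whose free ends are labeled $x_1,\dots,x_s$, with coefficient $1$; (ii) $\hat\theta^{1,k,s}:=0$ for $k>0$; (iii) for $n>1$, $$\hat\theta^{n,k,s}:=\frac{1}{k+n-1}\sum_{\rho=1}^{k+1}\sum_{i=1}^{n-1}q_i^{(\rho)}(\hat\theta^{n-1,k+1-\rho,s}).$$ Then, for all fixed $n$ and $k$, $\hat\theta^{n,k,s}=\sum_{G\in V_{\mathrm{loopless}}^{n,k,s}}\alpha_G\,G$ with $\alpha_G\in\mathbb{Q}$ and $\alpha_G>0$ for all $G\in V_{\mathrm{loopless}}^{n,k,s}$. Moreover, for every isomorphism class $\mathscr{C}\subseteq V_{\mathrm{loopless}}^{n,k,s}$, $$\sum_{G\in\mathscr{C}}\alpha_G=\frac{1}{S^{\mathscr{C}}},$$ where $S^{\mathscr{C}}$ denotes the symmetry factor of the graphs in $\mathscr{C}$.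
   Context: Graphs. A graph consists of a finite nonempty set $V$ of vertices, a finite set $K$ of ends of edges, and a partition $E$ of $K$ into two-element subsets, called edges; $E=E_{\mathrm{int}}\sqcup E_{\mathrm{ext}}$. Each end of an internal edge (element of $E_{\mathrm{int}}$) is assigned to a vertex; for each external edge (element of $E_{\mathrm{ext}}$) one end is assigned to a vertex and the other end is free. If there are $s$ external edges, their free ends carry distinct labels $x_1,\dots,x_s$. An internal edge with both ends assigned to the same vertex is a loop; a graph is loopless if it has no loops (multiple edges are allowed). A graph is connected if any two distinct vertices are joined by a path of internal edges (a single vertex is connected). The cyclomatic number is $k=m-n+c$, where $m=|E_{\mathrm{int}}|$, $n=|V|$ and $c$ is the number of connected components. Isomorphisms. An isomorphism of graphs is a pair of bijections $\psi_V:V\to V^*$, $\psi_K:K\to K^*$ that maps internal edges to internal edges and external edges to external edges, respects the assignment of ends to vertices (and free ends), and preserves the labels of the external edges. The symmetry factor $S^G$ is the order of the group of automorphisms $(\psi_V,\psi_K)$ of $G$; it is constant on isomorphism classes. Sets of graphs. $V^{n,k,s}$ is the set of all graphs with vertex set $\{v_1,\dots,v_n\}$, cyclomatic number $k$, and $s$ external edges whose free ends are labeled $x_1,\dots,x_s$; the vertices are ordered (labeled), while graphs that differ only by renaming the ends of edges (i.e. that are isomorphic via some $(\psi_V,\psi_K)$ with $\psi_V=\mathrm{id}$) are identified. $V_{\mathrm{loopless}}^{n,k,s}\subseteq V^{n,k,s}$ is the subset of loopless connected graphs. An isomorphism class $\mathscr{C}\subseteq V_{\mathrm{loopless}}^{n,k,s}$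 is an equivalence class under isomorphism, where $\psi_V$ may permute $v_1,\dots,v_n$. For a set $W$, $\mathbb{Q}W$ is the free $\mathbb{Q}$-vector space on $W$. Linear maps, defined on graphs $G\in V^{n,k,s}$ and extended linearly: - $l_{i,j}(G)$, $i\ne j$, is $G$ with one additional internal edge joining $v_i$ and $v_j$; $l_{i,j}^{\rho}$ is the $\rho$-fold composition of $l_{i,j}$. - $s_i(G)$, $1\le i\le n$: let $\mathcal{E}_i$ be the set of all ends (of internal and external edges) assigned to $v_i$. Then $s_i(G)=\sum G_{(\mathcal{E}^{(1)},\mathcal{E}^{(2)})}$, the sum being over all ordered pairs of disjoint, possibly empty sets with $\mathcal{E}^{(1)}\cup\mathcal{E}^{(2)}=\mathcal{E}_i$, where $G_{(\mathcal{E}^{(1)},\mathcal{E}^{(2)})}$ is obtained from $G$ by adding a new vertex $v_{n+1}$, keeping the ends in $\mathcal{E}^{(1)}$ at $v_i$, and reassigning the ends in $\mathcal{E}^{(2)}$ to $v_{n+1}$. - For an integer $\rho\ge1$, $q_i^{(\rho)}:=\frac{1}{2(\rho-1)!}\, l_{i,n+1}^{\rho}\circ s_i:\mathbb{Q}V^{n,k,s}\to\mathbb{Q}V^{n+1,k+\rho-1,s}$. *)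

(* Defs.v *)
From HB Require Import structures.
From mathcomp Require Import all_boot all_order all_algebra.
From mathcomp.multinomials Require Export freeg.

Set Implicit Arguments.
Unset Strict Implicit.
Unset Printing Implicit Defensive.

Import GRing.Theory.
Local Open Scope quotient_scope.

Section Graphs.

Variables (V K : finType) (s : nat).

Definition is_free (z : V + 'I_s) : bool := if z is inr _ then true else false.

(* Ei and Ee are the sets of internal and of external edges; at_ sends an end *)
(* to inl v if it is assigned to the vertex v, and to inr j if it is free and *)
(* carries the label x_j.                                                     *)
Definition is_graph (D : {set {set K}} * {set {set K}} * {ffun K -> V + 'I_s}) :=
  let: (Ei, Ee, at_) := D in
  [&& 0 < #|V|, [disjoint Ei & Ee], partition (Ei :|: Ee) [set: K],
      [forall e in Ei :|: Ee, #|e| == 2],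
      [forall e in Ei, forall x in e, ~~ is_free (at_ x)],
      [forall e in Ee, #|[set x in e | is_free (at_ x)]| == 1]
    & [forall j : 'I_s, #|[set x | at_ x == inr j]| == 1]].

Record graph := Graph {
  gdata :> {set {set K}} * {set {set K}} * {ffun K -> V + 'I_s};
  _ : is_graph gdata }.

HB.instance Definition _ := [isSub for gdata].
HB.instance Definition _ := [Finite of graph by <:].

Definition Eint (G : graph) : {set {set K}} := (gdata G).1.1.
Definition Eext (G : graph) : {set {set K}} := (gdata G).1.2.
Definition place (G : graph) : {ffun K -> V + 'I_s} := (gdata G).2.

Definition ends_at (G : graph) (v : V) : {set K} := [set x | place G x == inl v].

Definition loopless (G : graph) : bool :=
  ~~ [exists e in Eint G, exists v, e \subset ends_at G v].

Definition adj (G : graph) : rel V := fun v w =>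
  [exists e in Eint G, exists x in e, exists y in e,
    [&& x != y, x \in ends_at G v & y \in ends_at G w]].

Definition connected (G : graph) : bool :=
  [forall v, forall w, connect (adj G) v w].

Definition cyclomatic (G : graph) : int :=
  (#|Eint G|%:Z - #|V|%:Z + (n_comp (adj G) V)%:Z)%R.

End Graphs.

Arguments is_free {V s} z.

Definition bijectiveb (A B : finType) (f : {ffun A -> B}) : bool :=
  injectiveb f && [forall y, y \in codom f].

Definition map_vertex (V V' : finType) (s : nat) (f : V -> V') (z : V + 'I_s)
    : V' + 'I_s :=
  match z with inl v => inl (f v) | inr j => inr j end.

Section Isomorphisms.

Variable s : nat.

Definition is_iso (V V' K K' : finType) (psiV : {ffun V -> V'})
    (psiK : {ffun K -> K'}) (G : graph V K s) (G' : graph V' K' s) : bool :=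
  [&& bijectiveb psiV, bijectiveb psiK,
      [set psiK @: (e : {set K}) | e in Eint G] == Eint G',
      [set psiK @: (e : {set K}) | e in Eext G] == Eext G'
    & [forall x, place G' (psiK x) == map_vertex psiV (place G x)]].

Definition isomorphic (V V' K K' : finType) (G : graph V K s)
    (G' : graph V' K' s) : bool :=
  [exists psiV : {ffun V -> V'}, exists psiK : {ffun K -> K'},
    is_iso psiV psiK G G'].

Definition renaming (V K K' : finType) (G : graph V K s) (G' : graph V K' s)
    : bool :=
  [exists psiK : {ffun K -> K'}, is_iso [ffun v => v] psiK G G'].

Definition symmetry_factor (V K : finType) (G : graph V K s) : nat :=
  #|[set psi : {ffun V -> V} * {ffun K -> K} | is_iso psi.1 psi.2 G G]|.

End Isomorphisms.

Lemma bijectivebP (A B : finType) (f : {ffun A -> B}) :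
  reflect (bijective f) (bijectiveb f).
Proof.
apply: (iffP andP) => [[/injectiveP fI /forallP fS]|[g fK gK]].
  by exists (fun y => iinv (fS y)) => [x|y]; [apply: fI|]; rewrite f_iinv.
split; first by apply/injectiveP; apply: can_inj fK.
by apply/forallP => y; apply/codomP; exists (g y); rewrite gK.
Qed.

Lemma bijectiveb_id (A : finType) : bijectiveb [ffun x : A => x].
Proof. by apply/bijectivebP; exists id => x; rewrite ffunE. Qed.

Lemma imsetK (A B : finType) (f : A -> B) (g : B -> A) (X : {set A}) :
  cancel f g -> g @: (f @: X) = X.
Proof.
by move=> fK; rewrite -imset_comp (eq_imset _ (g := id)) ?imset_id // => x /=.
Qed.

Section IsoEquiv.

Variable s : nat.

Lemma is_isoP (V V' K K' : finType) (psiV : {ffun V -> V'})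
    (psiK : {ffun K -> K'}) (G : graph V K s) (G' : graph V' K' s) :
  reflect [/\ bijective psiV, bijective psiK,
      [set psiK @: (e : {set K}) | e in Eint G] = Eint G',
      [set psiK @: (e : {set K}) | e in Eext G] = Eext G'
    & forall x, place G' (psiK x) = map_vertex psiV (place G x)]
  (is_iso psiV psiK G G').
Proof.
by apply: (iffP and5P) => -[/bijectivebP? /bijectivebP? /eqP? /eqP? H]; split=> //;
  [move=> x; apply/eqP/(forallP H) | apply/forallP=> x; apply/eqP].
Qed.

Lemma is_iso_refl (V K : finType) (G : graph V K s) :
  is_iso [ffun v => v] [ffun x => x] G G.
Proof.
have E (X : {set K}) : [ffun x => x] @: X = X.
  by rewrite (eq_imset _ (g := id)) ?imset_id // => x; rewrite ffunE.
apply/is_isoP; split; try exact/bijectivebP/bijectiveb_id.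
- by rewrite (eq_imset _ E) imset_id.
- by rewrite (eq_imset _ E) imset_id.
- by move=> x; rewrite [in LHS]ffunE; case: (place G x) => //= v; rewrite ffunE.
Qed.

Lemma is_iso_inv (V V' K K' : finType) (psiV : {ffun V -> V'})
    (psiK : {ffun K -> K'}) (psiV' : {ffun V' -> V}) (psiK' : {ffun K' -> K})
    (G : graph V K s) (G' : graph V' K' s) :
  cancel psiV psiV' -> cancel psiV' psiV -> cancel psiK psiK' ->
  cancel psiK' psiK -> is_iso psiV psiK G G' -> is_iso psiV' psiK' G' G.
Proof.
move=> VK KV KK KK' /is_isoP[_ _ HI HE H]; apply/is_isoP; rewrite -HI -HE.
have E (Y : {set {set K}}) :
    [set psiK' @: (e : {set K'}) |
      e in [set psiK @: (e : {set K}) | e in Y]] = Y.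
  by apply: imsetK => X; apply: imsetK.
split=> //; [by exists psiV | by exists psiK |].
by move=> x; rewrite -{2}[x]KK' H; case: (place G _) => // v; rewrite /map_vertex VK.
Qed.

Lemma is_iso_comp (V V' V'' K K' K'' : finType) (psiV : {ffun V -> V'})
    (psiK : {ffun K -> K'}) (phiV : {ffun V' -> V''}) (phiK : {ffun K' -> K''})
    (G : graph V K s) (G' : graph V' K' s) (G'' : graph V'' K'' s) :
  is_iso psiV psiK G G' -> is_iso phiV phiK G' G'' ->
  is_iso [ffun v => phiV (psiV v)] [ffun x => phiK (psiK x)] G G''.
Proof.
move=> /is_isoP[bV bK HI HE H] /is_isoP[bV' bK' HI' HE' H'].
apply/is_isoP; rewrite -HI' -HE' -HI -HE.
have E (X : {set K}) : [ffun x => phiK (psiK x)] @: X = phiK @: (psiK @: X).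
  by rewrite -imset_comp; apply: eq_imset => x; rewrite ffunE.
split.
- by apply: (eq_bij (bij_comp bV' bV)) => v; rewrite ffunE.
- by apply: (eq_bij (bij_comp bK' bK)) => v; rewrite ffunE.
- by rewrite -imset_comp; apply: eq_imset => X; rewrite E.
- by rewrite -imset_comp; apply: eq_imset => X; rewrite E.
- by move=> x; rewrite ffunE H' H; case: (place G _) => // v; rewrite /map_vertex ffunE.
Qed.

Lemma renaming_refl (V K : finType) (G : graph V K s) : renaming G G.
Proof. by apply/existsP; exists [ffun x => x]; apply: is_iso_refl. Qed.

Lemma renaming_symm (V K K' : finType) (G : graph V K s) (G' : graph V K' s) :
  renaming G G' -> renaming G' G.
Proof.
case/existsP=> f fI; have /is_isoP[_ [g fK gK] _ _ _] := fI.
apply/existsP; exists [ffun x => g x].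
by apply: is_iso_inv fI => x; rewrite !ffunE.
Qed.

Lemma renaming_tran (V K K' K'' : finType) (G : graph V K s)
    (G' : graph V K' s) (G'' : graph V K'' s) :
  renaming G G' -> renaming G' G'' -> renaming G G''.
Proof.
case/existsP=> f fI /existsP[g gI]; apply/existsP.
exists [ffun x => g (f x)]; have := is_iso_comp fI gI.
by congr is_iso; apply/ffunP => v; rewrite !ffunE.
Qed.

End IsoEquiv.

(* Every finite set of ends can be renamed to some 'I_p, so the graphs on a   *)
(* fixed vertex set, up to renaming of their ends, form the quotient of the   *)
(* graphs with ends 'I_p, p arbitrary.                                        *)
Section Quotient.

Variables (n s : nat).

Definition pregraph := {p : nat & graph 'I_n 'I_p s}.

Definition same_graph : rel pregraph :=
  fun G H => renaming (tagged G) (tagged H).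

Lemma same_graph_refl : reflexive same_graph.
Proof. by move=> G; apply: renaming_refl. Qed.

Lemma same_graph_sym : symmetric same_graph.
Proof. by move=> G H; apply/idP/idP; apply: renaming_symm. Qed.

Lemma same_graph_trans : transitive same_graph.
Proof. by move=> H G I; apply: renaming_tran. Qed.

Canonical same_graph_equiv :=
  EquivRel same_graph same_graph_refl same_graph_sym same_graph_trans.

Definition vgraph := {eq_quot same_graph}.

HB.instance Definition _ := Choice.on vgraph.
HB.instance Definition _ := Quotient.on vgraph.
HB.instance Definition _ : EqQuotient _ same_graph vgraph := EqQuotient.on vgraph.

Definition rep (G : vgraph) : graph 'I_n 'I_(tag (repr G)) s := tagged (repr G).

End Quotient.

Section Relabel.

Variables (V K K' : finType) (s : nat) (f : K -> K') (g : K' -> K).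
Hypotheses (fK : cancel f g) (gK : cancel g f).

Lemma relabel_subproof (G : graph V K s) :
  is_graph ([set f @: (e : {set K}) | e in Eint G],
            [set f @: (e : {set K}) | e in Eext G],
            [ffun y => place G (g y)]).
Proof.
have fI := can_inj fK; have FI := imset_inj fI.
case: G => -[[Ei Ee] a] /=; rewrite /Eint /Eext /place /=.
case/and5P=> V0 dIE pE c2 /and3P[hI hE hS]; rewrite /is_graph V0 /=.
have fP (X : {set K}) : f @: X = [set y | g y \in X].
  apply/setP=> y; rewrite inE; apply/imsetP/idP=> [[x xX ->]|gX].
    by rewrite fK.
  by exists (g y); rewrite ?gK.
have cf (P : pred K) : #|[set y | P (g y)]| = #|[set x | P x]|.
  by rewrite -(card_imset _ fI) fP; apply: eq_card => y; rewrite !inE.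
rewrite -imsetU; apply/and5P; split.
- by rewrite imset_disjoint.
- suff -> : [set: K'] = f @: [set: K] by rewrite imset_partition.
  by rewrite fP; apply/setP=> y; rewrite !inE.
- apply/forall_inP=> _ /imsetP[e eE ->].
  by rewrite card_imset // (forall_inP c2).
- apply/forall_inP=> _ /imsetP[e eE ->]; apply/forall_inP=> _ /imsetP[x xe ->].
  by rewrite ffunE fK; apply: (forall_inP (forall_inP hI e eE)).
apply/andP; split.
- apply/forall_inP=> _ /imsetP[e eE ->].
  rewrite -(eqP (forall_inP hE e eE)) -cf; apply/eqP/eq_card=> y.
  by rewrite !inE ffunE fP inE.
- apply/forallP=> j; rewrite -(eqP (forallP hS j)) -cf; apply/eqP/eq_card=> y.
  by rewrite !inE ffunE.
Qed.

Definition relabel (G : graph V K s) : graph V K' s := Graph (relabel_subproof G).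

Lemma renaming_relabel (G : graph V K s) : renaming G (relabel G).
Proof.
apply/existsP; exists [ffun x => f x].
have E (X : {set K}) : [ffun x => f x] @: X = f @: X.
  by apply: eq_imset => x; rewrite ffunE.
apply/is_isoP; split.
- exact/bijectivebP/bijectiveb_id.
- by exists g => x; rewrite ffunE.
- exact: eq_imset.
- exact: eq_imset.
move=> x; rewrite /place [LHS]ffunE [X in g X]ffunE fK -/(place G).
by case: (place G x) => // v; rewrite /map_vertex ffunE.
Qed.

End Relabel.

Section ClassOf.

Variables (n s : nat) (K : finType).

Definition class_of (G : graph 'I_n K s) : vgraph n s :=
  \pi_(vgraph n s) (Tagged (fun p => graph 'I_n 'I_p s)
         (relabel (@enum_rankK K) (@enum_valK K) G)).

Lemma renaming_rep_class_of (G : graph 'I_n K s) : renaming G (rep (class_of G)).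
Proof.
apply: (renaming_tran (renaming_relabel (@enum_rankK K) (@enum_valK K) G)).
have /eqmodP : repr (class_of G) = Tagged (fun p => graph 'I_n 'I_p s)
    (relabel (@enum_rankK K) (@enum_valK K) G) %[mod vgraph n s].
  by rewrite reprK.
by move=> H; apply: (renaming_symm H).
Qed.

End ClassOf.

Lemma class_ofP (n s : nat) (K K' : finType) (G : graph 'I_n K s)
    (G' : graph 'I_n K' s) :
  reflect (class_of G = class_of G') (renaming G G').
Proof.
have R1 := renaming_relabel (@enum_rankK K) (@enum_valK K) G.
have R2 := renaming_relabel (@enum_rankK K') (@enum_valK K') G'.
apply: (iffP idP) => [H|/eqmodP H].
  apply/eqmodP; apply: renaming_tran (renaming_tran (renaming_symm R1) H) R2.
exact: renaming_tran (renaming_tran R1 H) (renaming_symm R2).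
Qed.

Lemma class_of_rep (n s : nat) (G : vgraph n s) : class_of (rep G) = G.
Proof.
rewrite -[RHS]reprK; apply/eqmodP; apply: renaming_symm.
exact: renaming_relabel.
Qed.

(* The two new ends are inr false, assigned to i, and inr true, assigned to j. *)
Section AddEdge.

Variables (V K : finType) (s : nat) (i j : V).

Lemma add_edge_subproof (G : graph V K s) :
  is_graph ([set inr false; inr true] |:
              [set inl @: (e : {set K}) | e in Eint G],
            [set inl @: (e : {set K}) | e in Eext G],
            [ffun x : K + bool => match x with
                                  | inl x => place G x
                                  | inr b => inl (if b then j else i)
                                  end]).
Proof.
have fI : injective (@inl K bool) by move=> x y [].
have FI := imset_inj fI.
case: G => -[[Ei Ee] a] /=; rewrite /Eint /Eext /place /=.
case/and5P=> V0 dIE pE c2 /and3P[hI hE hS]; rewrite /is_graph V0 /=.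
set N := [set inr false; inr true].
have Ninl (X : {set K}) : [disjoint N & inl @: X].
  apply/pred0P=> -[x|b]; rewrite /= !inE //.
  by apply/andP=> -[_ /imsetP[]].
have N0 : N != set0 by apply/set0Pn; exists (inr true); rewrite !inE eqxx orbT.
have NE (Y : {set {set K}}) : N \notin [set inl @: (e : {set K}) | e in Y].
  apply/negP=> /imsetP[e _ Ne].
  by have := Ninl e; rewrite -Ne -setI_eq0 setIid (negbTE N0).
have EP (x : K) (X : {set K}) : (inl x \in [set (inl y : K + bool) | y in X]) = (x \in X).
  exact: mem_imset.
have EN (b : bool) (X : {set K}) : (inr b \in [set (inl y : K + bool) | y in X]) = false.
  by apply/imsetP=> -[].
have cf (P : pred (K + bool)) : (forall b, P (inr b) = false) ->
    #|[set y | P y]| = #|[set x | P (inl x)]|.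
  move=> Pb; rewrite -(card_imset _ fI); apply: eq_card => -[x|b].
    by rewrite EP !inE.
  by rewrite EN inE.
rewrite -setUA -imsetU; apply/and5P; split.
- rewrite -setI_eq0 setIUl setU_eq0 !setI_eq0 imset_disjoint // dIE andbT.
  by rewrite disjoints1.
- suff -> : [set: K + bool] = N :|: inl @: [set: K].
    by apply: partitionU1; rewrite ?imset_partition.
  by apply/setP=> -[x|[]]; rewrite !inE ?EP ?inE.
- apply/forall_inP=> e /setU1P[->|/imsetP[{}e eE ->]]; first by rewrite cards2.
  by rewrite card_imset // (forall_inP c2).
- apply/forall_inP=> e /setU1P[->|/imsetP[{}e eE ->]].
    by apply/forall_inP=> x /set2P[] ->; rewrite ffunE.
  apply/forall_inP=> _ /imsetP[x xe ->]; rewrite ffunE.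
  exact: (forall_inP (forall_inP hI e eE)).
apply/andP; split.
- apply/forall_inP=> _ /imsetP[e eE ->].
  rewrite -(eqP (forall_inP hE e eE)) cf.
    by apply/eqP/eq_card=> y; rewrite !inE ffunE EP.
  by move=> b; rewrite EN.
- apply/forallP=> l; rewrite -(eqP (forallP hS l)) cf.
    by apply/eqP/eq_card=> y; rewrite !inE ffunE.
  by move=> b; rewrite ffunE.
Qed.

Definition add_edge (G : graph V K s) : graph V (K + bool)%type s :=
  Graph (add_edge_subproof G).

End AddEdge.

(* The new vertex v_{n+1} is ord_max.  A free end in E2 would stay free, but  *)
(* E2 is always a set of ends assigned to v_i below.                          *)
Section Split.

Variables (n : nat) (K : finType) (s : nat) (E2 : {set K}).

Lemma split_subproof (G : graph 'I_n K s) :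
  is_graph (Eint G, Eext G,
            [ffun x => match place G x with
                       | inl v => inl (if x \in E2 then ord_max
                                       else widen_ord (leqnSn n) v)
                       | inr l => inr l
                       end : 'I_n.+1 + 'I_s]).
Proof.
case: G => -[[Ei Ee] a] /=; rewrite /Eint /Eext /place /=.
case/and5P=> V0 dIE pE c2 /and3P[hI hE hS].
rewrite /is_graph card_ord dIE pE c2 /=; apply/and3P; split.
- apply/forall_inP=> e eE; apply/forall_inP=> x xe; rewrite ffunE.
  by have := forall_inP (forall_inP hI e eE) x xe; case: (a x).
- apply/forall_inP=> e eE; rewrite -(eqP (forall_inP hE e eE)).
  by apply/eqP/eq_card=> x; rewrite !inE ffunE; case: (a x).
- apply/forallP=> l; rewrite -(eqP (forallP hS l)).
  by apply/eqP/eq_card=> x; rewrite !inE ffunE; case: (a x).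
Qed.

Definition split_vertex (G : graph 'I_n K s) : graph 'I_n.+1 K s :=
  Graph (split_subproof G).

End Split.

(* The j-th external edge has the end (j, false), assigned to the vertex, and *)
(* the free end (j, true).                                                    *)
Section Single.

Variable s : nat.

Lemma single_subproof :
  is_graph (set0, [set [set (j, false); (j, true)] | j : 'I_s],
            [ffun x : 'I_s * bool => if x.2 then inr x.1 else inl ord0
                                     : 'I_1 + 'I_s]).
Proof.
have mE (j : 'I_s) x : (x \in [set (j, false); (j, true)]) = (x.1 == j).
  by case: x => l b; rewrite !inE !xpair_eqE; case: b; rewrite ?andbT ?andbF ?orbF.
have cE (j : 'I_s) (P : pred ('I_s * bool)) :
    (forall x, P x = (x == (j, true))) -> #|[set x | P x]| == 1.
  by move=> E; rewrite -(cards1 (j, true)); apply/eqP/eq_card=> x; rewrite !inE E.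
rewrite /is_graph card_ord set0U /=; apply/and5P; split.
- by rewrite -setI_eq0 set0I.
- apply/and3P; split.
  + rewrite -subTset; apply/subsetP=> x _; apply/bigcupP.
    exists [set (x.1, false); (x.1, true)]; last by rewrite mE.
    by apply/imsetP; exists x.1.
  + apply/trivIsetP=> _ _ /imsetP[j _ ->] /imsetP[l _ ->] jl.
    apply/pred0P=> x; rewrite /= !mE; apply/andP=> -[/eqP xj /eqP xl].
    by rewrite -xj -xl eqxx in jl.
  + apply/imsetP=> -[j _ /setP/(_ (j, true))].
    by rewrite mE inE eqxx.
- by apply/forall_inP=> _ /imsetP[j _ ->]; rewrite cards2 xpair_eqE eqxx.
- by apply/forall_inP=> e; rewrite inE.
apply/andP; split.
- apply/forall_inP=> _ /imsetP[j _ ->]; apply: (cE j) => -[l b].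
  by rewrite mE ffunE xpair_eqE; case: b; rewrite /= ?andbT ?andbF.
- apply/forallP=> j; apply: (cE j) => -[l b].
  by rewrite ffunE xpair_eqE; case: b; rewrite /= ?andbT ?andbF.
Qed.

Definition single_vertex : graph 'I_1 ('I_s * bool)%type s := Graph single_subproof.

End Single.

Section WellDefined.

Variables (n s : nat) (K K' : finType).
Variables (G : graph 'I_n K s) (G' : graph 'I_n K' s).

Lemma add_edge_renaming (i j : 'I_n) :
  renaming G G' -> renaming (add_edge i j G) (add_edge i j G').
Proof.
case/existsP=> f /is_isoP[_ [g fK gK] HI HE H].
pose F : {ffun K + bool -> K' + bool} :=
  [ffun x => match x with inl x => inl (f x) | inr b => inr b end].
have Finl (X : {set K}) : F @: (inl @: X) = inl @: (f @: X).
  by rewrite -!imset_comp; apply: eq_imset => x; rewrite /= ffunE.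
have FF (Y : {set {set K}}) :
    [set F @: (e : {set _}) | e in [set inl @: (e : {set K}) | e in Y]] =
    [set inl @: (e : {set K'}) | e in [set f @: (e : {set K}) | e in Y]].
  by rewrite -!imset_comp; apply: eq_imset => X; rewrite /= Finl.
apply/existsP; exists F; apply/is_isoP; split.
- exact/bijectivebP/bijectiveb_id.
- exists (fun x => match x with inl x => inl (g x) | inr b => inr b end).
    by case=> [x|b]; rewrite ffunE ?fK.
  by case=> [x|b]; rewrite ffunE ?gK.
- rewrite /Eint /= imsetU1 FF -/(Eint G) -/(Eint G') HI.
  by rewrite imsetU1 imset_set1 !ffunE.
- by rewrite /Eext /= FF -/(Eext G) -/(Eext G') HE.
case=> [x|b]; rewrite /place /= [F _]ffunE !ffunE /=.
  by rewrite -/(place G') -/(place G) H; case: (place G x) => // v;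
     rewrite /= !ffunE.
by rewrite ffunE.
Qed.

Lemma split_vertex_iso (f : {ffun K -> K'}) (E2 : {set K}) :
  is_iso [ffun v => v] f G G' ->
  is_iso [ffun v => v] f (split_vertex E2 G) (split_vertex (f @: E2) G').
Proof.
case/is_isoP=> _ fB HI HE H; apply/is_isoP; split=> //.
  exact/bijectivebP/bijectiveb_id.
move=> x; rewrite /place /= !ffunE -/(place G') -/(place G) H.
rewrite mem_imset; last exact: bij_inj.
by case: (place G x) => [v|] //=; rewrite !ffunE.
Qed.

End WellDefined.

(* All notions read off from rep G are invariant under renaming of the ends.  *)
Definition V_set (n k s : nat) : {pred vgraph n s} :=
  fun G => (cyclomatic (rep G) == k%:Z)%R.
Arguments V_set n k s _ : clear implicits.

Definition V_loopless (n k s : nat) : {pred vgraph n s} :=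
  fun G => [&& G \in V_set n k s, connected (rep G) & loopless (rep G)].
Arguments V_loopless n k s _ : clear implicits.

Section VertexGraphs.

Variables (n s : nat).
Implicit Types G H : vgraph n s.

Definition iso_class (C : {pred vgraph n s}) : Prop :=
  exists G, forall H, (H \in C) = isomorphic (rep G) (rep H).

Definition symfactor (G : vgraph n s) : nat := symmetry_factor (rep G).

Local Open Scope ring_scope.

Definition l_ (i j : 'I_n) : {freeg (vgraph n s) / rat} -> {freeg (vgraph n s) / rat} :=
  fglift (fun G => << class_of (add_edge i j (rep G)) >>).

Definition s_ (i : 'I_n) :
    {freeg (vgraph n s) / rat} -> {freeg (vgraph n.+1 s) / rat} :=
  fglift (fun G =>
    \sum_(E : {set _} * {set _} |
            [disjoint E.1 & E.2] && (E.1 :|: E.2 == ends_at (rep G) i))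
      << class_of (split_vertex E.2 (rep G)) >>).

Lemma l_class_of (K : finType) (G : graph 'I_n K s) (i j : 'I_n) :
  l_ i j << class_of G >> = << class_of (add_edge i j G) >>.
Proof.
rewrite /l_ liftU scale1r; congr << _ >>; apply/class_ofP/add_edge_renaming.
exact/renaming_symm/renaming_rep_class_of.
Qed.

Lemma s_class_of (K : finType) (G : graph 'I_n K s) (i : 'I_n) :
  s_ i << class_of G >> =
    \sum_(E : {set K} * {set K} |
            [disjoint E.1 & E.2] && (E.1 :|: E.2 == ends_at G i))
      << class_of (split_vertex E.2 G) >>.
Proof.
rewrite /s_ liftU scale1r.
have /existsP[f fI] := renaming_rep_class_of G.
have /is_isoP[_ fB _ _ H] := fI; have [g fK gK] := fB.
pose F (E : {set K} * {set K}) := (f @: E.1, f @: E.2).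
rewrite (reindex F) /=; last first.
  exists (fun E : {set _} * {set _} => (g @: E.1, g @: E.2)) => -[E1 E2] _;
    by congr pair; apply: imsetK.
apply: eq_big => [[E1 E2]|[E1 E2] _] /=.
  rewrite imset_disjoint; last exact: (can_inj fK).
  congr (_ && _); rewrite -imsetU.
  suff -> : ends_at (rep (class_of G)) i = f @: ends_at G i.
    by rewrite (inj_eq (imset_inj (can_inj fK))).
  apply/setP=> y; rewrite -[y]gK mem_imset ?inE ?H; last exact: (can_inj fK).
  by case: (place G _) => // v; rewrite /= !ffunE.
congr << _ >>; apply/class_ofP/renaming_symm/existsP; exists f.
exact: split_vertex_iso.
Qed.

End VertexGraphs.

Local Open Scope ring_scope.

Definition q_ (n s : nat) (i : 'I_n) (rho : nat) (x : {freeg (vgraph n s) / rat}) :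
    {freeg (vgraph n.+1 s) / rat} :=
  (2 * (rho.-1)`!%:R)^-1 *:
    iter rho (l_ (widen_ord (leqnSn n) i) ord_max) (s_ i x).

(* theta_succ m k s is \hat\theta^{m+1,k,s}. *)
Fixpoint theta_succ (m k s : nat) {struct m} : {freeg (vgraph m.+1 s) / rat} :=
  match m with
  | 0 => if k == 0%N then << class_of (single_vertex s) >> else 0
  | m'.+1 =>
      (k + m'.+1)%:R^-1 *:
        \sum_(1 <= rho < k.+2) \sum_(i < m'.+1)
           q_ i rho (theta_succ m' (k.+1 - rho) s)
  end.

(* The value at n = 0 is irrelevant. *)
Definition theta (n k s : nat) : {freeg (vgraph n s) / rat} :=
  match n with 0 => 0 | m.+1 => theta_succ m k s end.

Lemma theta1 (k s : nat) :
  theta 1 k s = if k == 0%N then << class_of (single_vertex s) >> else 0.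
Proof. by []. Qed.

Lemma theta_rec (n k s : nat) : (0 < n)%N ->
  theta n.+1 k s = (k + n)%:R^-1 *:
    \sum_(1 <= rho < k.+2) \sum_(i < n) q_ i rho (theta n (k.+1 - rho) s).
Proof. by case: n. Qed.

(* Main.v *)
From HB Require Import structures.
Require Import Defs.
From mathcomp Require Import all_boot all_order all_algebra.
From mathcomp Require Import fingroup perm zify ring.

(** A numbered graph is a list [t] of oriented edges between the vertices,
    together with a map [h] that says where the external edges are attached;
    [cls t h] is the graph that it describes.  Permuting the edges, reversing
    some of them and permuting the vertices acts on the numbered graphs with
    [n] vertices and [m] edges, the orbits are the isomorphism classes, and the
    stabilizers are the automorphism groups.  Hence a class C consists of
    n! m! 2^m / S^C numbered graphs ([card_numberings]), and the formula for the
    class sums says that, for every function [phi] of graphs that is invariant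
    under permutations of the vertices, the linear extension of [phi] takes on
    theta^{n,k,s} the value

      1 / (2^m m! n!) * sum of phi (cls t h) over the connected loopless (t, h),

    where m = k + n - 1 ([ev_theta]; there the number of vertices is [n.+1], so
    that m is [k + n]).

    This is proved by induction on n.  On numbered graphs the operators are
    transparent.  Splitting v_i in (t', h') gives all the (t, h) that become
    (t', h') when the last vertex is merged into v_i ([s_cls]), and adding an
    edge puts it in front of the list.  So, when the induction hypothesis is
    inserted, q_i^(rho) produces all the lists that start with rho copies of the
    edge from v_i to the last vertex and contain no further edge parallel to it;
    such a list is connected and loopless exactly if the merged one is
    ([conn_loopless_merge]).  Letting the rho parallel edges take arbitrary
    positions and orientations contributes a factor C(m, rho) 2^rho
    ([sum_count_between]).  Together with 1 / (2 (rho - 1)!) and with the two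
    normalizations this leaves the factor rho / 2 ([norm_sub]): in the sum over
    rho every numbered graph is weighted by half the number of its edges between
    v_i and the last vertex, and in the sum over i by half the degree of the
    last vertex.  By symmetry this degree may be replaced by the average degree
    of the vertices ([sum_weight_incident]), whose sum is 2m.  The factor m
    cancels the prefactor of the recursion, and the average supplies the missing
    factor in the factorial of the number of vertices.

    The signs need no averaging.  All the coefficients are nonnegative, and a
    connected loopless graph has an edge between its last vertex and some v_i;
    merging the two gives a connected loopless graph with fewer vertices, of
    which the given graph is one of the splittings ([coeff_theta]). *)
Set Implicit Arguments.
Unset Strict Implicit.
Unset Printing Implicit Defensive.

Import Order.TTheory GRing.Theory Num.Theory.

(** * Isomorphism invariants *)

Section Invariants.

Variable s : nat.

Lemma isomorphic_refl (V K : finType) (G : graph V K s) : isomorphic G G.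
Proof.
by apply/existsP; exists [ffun v => v]; apply/existsP; exists [ffun x => x];
  apply: is_iso_refl.
Qed.

Lemma isomorphic_sym (V V' K K' : finType) (G : graph V K s)
    (G' : graph V' K' s) : isomorphic G G' -> isomorphic G' G.
Proof.
case/existsP=> psiV /existsP[psiK psi].
have /is_isoP[[gV VK KV] [gK KK KK'] _ _ _] := psi.
apply/existsP; exists [ffun v => gV v]; apply/existsP; exists [ffun x => gK x].
by apply: is_iso_inv psi => x; rewrite ffunE.
Qed.

Lemma isomorphic_trans (V V' V'' K K' K'' : finType) (G : graph V K s)
    (G' : graph V' K' s) (G'' : graph V'' K'' s) :
  isomorphic G G' -> isomorphic G' G'' -> isomorphic G G''.
Proof.
case/existsP=> psiV /existsP[psiK psi] /existsP[phiV /existsP[phiK phi]].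
apply/existsP; exists [ffun v => phiV (psiV v)]; apply/existsP.
by exists [ffun x => phiK (psiK x)]; apply: is_iso_comp psi phi.
Qed.

Lemma renaming_isomorphic (V K K' : finType) (G : graph V K s)
    (G' : graph V K' s) : renaming G G' -> isomorphic G G'.
Proof. by move=> ?; apply/existsP; exists [ffun v => v]. Qed.

Lemma isomorphic_card_Eint (V V' K K' : finType) (G : graph V K s)
    (G' : graph V' K' s) : isomorphic G G' -> #|Eint G| = #|Eint G'|.
Proof.
case/existsP=> psiV /existsP[psiK /is_isoP[_ bK <- _ _]].
by rewrite card_imset //; apply/imset_inj/bij_inj.
Qed.

Lemma isomorphic_loopless (V V' K K' : finType) (G : graph V K s)
    (G' : graph V' K' s) : isomorphic G G' -> loopless G = loopless G'.
Proof.
suff W (U U' L L' : finType) (H : graph U L s) (H' : graph U' L' s) :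
    isomorphic H H' -> loopless H' -> loopless H.
  by move=> GG'; apply/idP/idP; apply: W; rewrite // isomorphic_sym.
case/existsP=> psiV /existsP[psiK /is_isoP[_ _ HI _ HP]]; apply: contra.
case/exists_inP=> e eH /existsP[v /subsetP ev].
apply/exists_inP; exists (psiK @: e); first by rewrite -HI; apply: imset_f.
apply/existsP; exists (psiV v); apply/subsetP=> _ /imsetP[x xe ->].
by have := ev x xe; rewrite !inE HP => /eqP ->.
Qed.

Lemma isomorphic_connected (V V' K K' : finType) (G : graph V K s)
    (G' : graph V' K' s) : isomorphic G G' -> connected G = connected G'.
Proof.
suff W (U U' L L' : finType) (H : graph U L s) (H' : graph U' L' s) :
    isomorphic H H' -> connected H -> connected H'.
  by move=> GG'; apply/idP/idP; apply: W; rewrite // isomorphic_sym.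
case/existsP=> psiV /existsP[psiK /is_isoP[[gV _ gVK] bK HI _ HP]] cH.
have adjH v w : adj H v w -> adj H' (psiV v) (psiV w).
  case/exists_inP=> e eH /exists_inP[x xe /exists_inP[y ye /and3P[xy xv yw]]].
  apply/exists_inP; exists (psiK @: e); first by rewrite -HI; apply: imset_f.
  apply/exists_inP; exists (psiK x); first exact: imset_f.
  apply/exists_inP; exists (psiK y); first exact: imset_f.
  rewrite (inj_eq (bij_inj bK)) xy /=.
  by move: xv yw; rewrite !inE !HP => /eqP-> /eqP->; rewrite /= !eqxx.
apply/forallP=> v; apply/forallP=> w; rewrite -[v]gVK -[w]gVK.
have /connectP[p] := forallP (forallP cH (gV v)) (gV w).
elim: p (gV v) => [|z p IH] u /=; first by move=> _ ->.
case/andP=> /adjH uz zp /(IH _ zp); exact/connect_trans/connect1.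
Qed.

Definition isos (V V' K K' : finType) (G : graph V K s) (G' : graph V' K' s) :=
  [set psi : {ffun V -> V'} * {ffun K -> K'} | is_iso psi.1 psi.2 G G'].

(** Composition with fixed isomorphisms on both sides is injective.  In
    particular, two isomorphic graphs have as many isomorphisms between them as
    each of them has automorphisms. *)
Lemma card_isos (V V' U U' K K' L L' : finType) (G : graph V K s)
    (G' : graph V' K' s) (H : graph U L s) (H' : graph U' L' s) :
  isomorphic G G' -> isomorphic H H' -> #|isos G H| = #|isos G' H'|.
Proof.
suff W (A A' B B' C C' D D' : finType) (X : graph A C s)
    (X' : graph A' C' s) (Y : graph B D s) (Y' : graph B' D' s) :
    isomorphic X' X -> isomorphic Y Y' -> #|isos X Y| <= #|isos X' Y'|.
  by move=> GG' HH'; apply/eqP; rewrite eqn_leq !W // isomorphic_sym.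
case/existsP=> phiV /existsP[phiK phi] /existsP[chiV /existsP[chiK chi]].
pose F (psi : {ffun A -> B} * {ffun C -> D}) :=
  ([ffun v => chiV (psi.1 (phiV v))], [ffun x => chiK (psi.2 (phiK x))]).
have /is_isoP[[f _ fK] [g _ gK] _ _ _] := phi.
have /is_isoP[/bij_inj chiVI /bij_inj chiKI _ _ _] := chi.
have FI : injective F.
  case=> a b [a' b'] /= [/ffunP aa' /ffunP bb']; congr pair; apply/ffunP=> x.
    by have := aa' (f x); rewrite !ffunE fK => /chiVI.
  by have := bb' (g x); rewrite !ffunE gK => /chiKI.
rewrite -(card_imset _ FI) subset_leq_card //; apply/subsetP=> _ /imsetP[psi psiP ->].
move: psiP; rewrite !inE => psiP; have := is_iso_comp phi (is_iso_comp psiP chi).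
by congr is_iso; apply/ffunP=> x; rewrite !ffunE.
Qed.

Lemma symmetry_factorE (V K : finType) (G : graph V K s) :
  symmetry_factor G = #|isos G G|.
Proof. by []. Qed.

Lemma adj_sym (V K : finType) (G : graph V K s) : symmetric (adj G).
Proof.
suff W v w : adj G v w -> adj G w v by move=> v w; apply/idP/idP; apply: W.
case/exists_inP=> e eG /exists_inP[x xe /exists_inP[y ye /and3P[xy xv yw]]].
apply/exists_inP; exists e => //; apply/exists_inP; exists y => //.
by apply/exists_inP; exists x; rewrite // eq_sym xy yw xv.
Qed.

Lemma connected_cyclomatic (V K : finType) (G : graph V K s) :
  connected G -> cyclomatic G = (#|Eint G|%:Z - #|V|%:Z + 1)%R.
Proof.
move=> cG; rewrite /cyclomatic; congr (_ + _%:Z)%R.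
have : (0 < #|V|)%N by case: G {cG} => -[[? ?] ?] /= /and5P[].
case/card_gt0P=> v _; rewrite -(n_comp_connect (sym_connect_sym (adj_sym G)) v).
by apply: eq_n_comp_r => w; rewrite [RHS](forallP (forallP cG v) w).
Qed.

End Invariants.

(** * Graphs with numbered and oriented edges *)

Section Labelled.

Variables n s m : nat.
Local Notation V := 'I_n.+1.

(** The edge [inl e] is internal and the edge [inr j] is external; the free end
    of the latter is [(inr j, true)]. *)
Definition ends := (('I_m + 'I_s) * bool)%type.

Definition edge (i : 'I_m + 'I_s) : {set ends} := [set (i, false); (i, true)].

Lemma in_edge i x : (x \in edge i) = (x.1 == i).
Proof.
by case: x => l b; rewrite !inE !xpair_eqE; case: b; rewrite ?andbT ?andbF ?orbF.
Qed.

Lemma edge_inj : injective edge.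
Proof. by move=> i j /setP/(_ (i, true)); rewrite !in_edge eqxx => /esym/eqP. Qed.

Lemma card_edge i : #|edge i| = 2.
Proof. by rewrite cards2 xpair_eqE andbF. Qed.

Variables (t : m.-tuple (V * V)) (h : {ffun 'I_s -> V}).

Definition place_of : {ffun ends -> V + 'I_s} :=
  [ffun x => match x.1 with
             | inl e => inl (if x.2 then (tnth t e).2 else (tnth t e).1)
             | inr j => if x.2 then inr j else inl (h j)
             end].

Lemma lgraph_subproof :
  is_graph ([set edge (inl e) | e : 'I_m], [set edge (inr j) | j : 'I_s], place_of).
Proof.
rewrite /is_graph card_ord /=.
have -> : [set edge (inl e) | e : 'I_m] :|: [set edge (inr j) | j : 'I_s]
          = [set edge i | i : 'I_m + 'I_s].
  apply/setP=> X; rewrite inE; apply/orP/imsetP => [[]|[[i|j] _ ->]].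
  - by case/imsetP=> e _ ->; exists (inl e).
  - by case/imsetP=> e _ ->; exists (inr e).
  - by left; apply: imset_f.
  - by right; apply: imset_f.
have cE (j : 'I_s) (P : pred ends) :
    (forall x, P x = (x == (inr j, true))) -> #|[set x | P x]| == 1.
  move=> E; rewrite -(cards1 (inr j : 'I_m + 'I_s, true)).
  by apply/eqP/eq_card=> x; rewrite !inE E.
apply/and5P; split.
- rewrite -setI_eq0; apply/eqP/setP=> X; rewrite !inE.
  by apply/andP=> -[/imsetP[e _ ->] /imsetP[j _ /edge_inj]].
- apply/and3P; split.
  + rewrite -subTset; apply/subsetP=> x _; apply/bigcupP.
    by exists (edge x.1); [apply: imset_f | rewrite in_edge].
  + apply/trivIsetP=> _ _ /imsetP[j _ ->] /imsetP[l _ ->] jl.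
    apply/pred0P=> x; rewrite /= !in_edge; apply/andP=> -[/eqP xj /eqP xl].
    by rewrite -xj -xl eqxx in jl.
  + apply/imsetP=> -[j _ /setP/(_ (j, true))].
    by rewrite in_edge inE eqxx.
- by apply/forall_inP=> _ /imsetP[j _ ->]; rewrite card_edge.
- apply/forall_inP=> _ /imsetP[e _ ->]; apply/forall_inP=> -[i b].
  by rewrite in_edge ffunE => /eqP /= ->.
apply/andP; split.
- apply/forall_inP=> _ /imsetP[j _ ->]; apply: (cE j) => -[l b].
  rewrite in_edge ffunE xpair_eqE; case: b; case: l => l;
    by rewrite /= ?andbT ?andbF.
- apply/forallP=> j; apply: (cE j) => -[l b].
  by rewrite ffunE xpair_eqE; case: b; case: l => l; rewrite /= ?andbT ?andbF.
Qed.

Definition lgraph : graph V ends s := Graph lgraph_subproof.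

Lemma place_lgraph : place lgraph = place_of.
Proof. by []. Qed.

Lemma card_Eint_lgraph : #|Eint lgraph| = m.
Proof.
rewrite /Eint card_imset ?card_ord // => e e' /edge_inj ee'; by case: ee'.
Qed.

Lemma adj_lgraph v w :
  adj lgraph v w = ((v, w) \in (t : seq _)) || ((w, v) \in (t : seq _)).
Proof.
apply/exists_inP/orP => [[_ /imsetP[e _ ->]]|vw].
  case/exists_inP=> x; rewrite in_edge => /eqP xe.
  case/exists_inP=> y; rewrite in_edge => /eqP ye.
  rewrite !inE place_lgraph !ffunE xe ye => /and3P[].
  rewrite -pair_eqE /pair_eq xe ye eqxx /=.
  case: x.2; case: y.2 => //= _ /eqP[<-] /eqP[<-]; [right | left];
    by rewrite -surjective_pairing mem_tnth.
have : exists e, tnth t e = (v, w) \/ tnth t e = (w, v).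
  by case: vw => /tnthP[e ->]; exists e; [left|right].
case=> e te; exists (edge (inl e)); first exact: imset_f.
case: te => te; apply/exists_inP.
  exists (inl e, false); first by rewrite in_edge eqxx.
  apply/exists_inP; exists (inl e, true); first by rewrite in_edge eqxx.
  by rewrite xpair_eqE andbF !inE place_lgraph !ffunE /= te !eqxx.
exists (inl e, true); first by rewrite in_edge eqxx.
apply/exists_inP; exists (inl e, false); first by rewrite in_edge eqxx.
by rewrite xpair_eqE andbF !inE place_lgraph !ffunE /= te !eqxx.
Qed.

Lemma loopless_lgraph : loopless lgraph = all (fun e => e.1 != e.2) t.
Proof.
rewrite /loopless; apply/idP/allP => [|tl].
  move=> /exists_inPn tl _ /tnthP[e ->]; apply: contra (tl (edge (inl e)) _).
    move=> /eqP te; apply/existsP; exists (tnth t e).1.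
    apply/subsetP=> -[i b]; rewrite in_edge inE place_lgraph ffunE => /eqP /= ->.
    by rewrite -te if_same.
  exact: imset_f.
apply/exists_inPn=> _ /imsetP[e _ ->]; apply/existsP=> -[v /subsetP ev].
have := tl _ (mem_tnth e t).
have := ev (inl e, false); rewrite in_edge inE place_lgraph ffunE /= eqxx => /(_ isT)/eqP[->].
have := ev (inl e, true); rewrite in_edge inE place_lgraph ffunE /= eqxx => /(_ isT)/eqP[->].
by rewrite eqxx.
Qed.

End Labelled.

Arguments edge {s m} i.

Definition joined (T : eqType) (t : seq (T * T)) : rel T :=
  fun v w => ((v, w) \in t) || ((w, v) \in t).

Definition conn_loopless (V : finType) (t : seq (V * V)) : bool :=
  all (fun e => e.1 != e.2) t && [forall v, forall w, connect (joined t) v w].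

Section Classes.

Variables n s : nat.
Local Notation V := 'I_n.+1.

(** Lists are used instead of tuples so that adding an edge is a [cons]. *)
Definition cls (t : seq (V * V)) (h : {ffun 'I_s -> V}) : vgraph n.+1 s :=
  class_of (lgraph (in_tuple t) h).

Lemma cls_tuple m (t : m.-tuple (V * V)) h : cls t h = class_of (lgraph t h).
Proof.
case: t => t tm /=; move: (eqP tm) => E; case: m / E tm => tm.
by congr (class_of (lgraph _ h)); apply: val_inj.
Qed.

Lemma isomorphic_rep_cls t h : isomorphic (rep (cls t h)) (lgraph (in_tuple t) h).
Proof. exact/renaming_isomorphic/renaming_symm/renaming_rep_class_of. Qed.

Lemma conn_loopless_cls t h :
  conn_loopless t = connected (rep (cls t h)) && loopless (rep (cls t h)).
Proof.
have iso := isomorphic_rep_cls t h.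
rewrite (isomorphic_connected iso) (isomorphic_loopless iso) loopless_lgraph.
rewrite /conn_loopless andbC; congr andb.
apply/eq_forallb=> v; apply/eq_forallb=> w.
by apply: eq_connect => x y; rewrite adj_lgraph.
Qed.

(** A connected graph with [n.+1] vertices and [m] internal edges has cyclomatic
    number [m - n]. *)
Lemma cls_V_loopless k (t : seq (V * V)) h :
  (cls t h \in V_loopless n.+1 k s) = (size t == k + n) && conn_loopless t.
Proof.
rewrite (conn_loopless_cls t h) unfold_in.
case cG : (connected (rep (cls t h))); rewrite ?andbF //=; congr andb.
rewrite unfold_in connected_cyclomatic //.
rewrite (isomorphic_card_Eint (isomorphic_rep_cls t h)).
by rewrite card_Eint_lgraph card_ord; lia.
Qed.

End Classes.

(** * Isomorphisms as permutations and flips of the numbered edges *)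

Definition flip (T : Type) (b : bool) (x : T * T) := if b then (x.2, x.1) else x.

Definition map_pair (T T' : Type) (f : T -> T') (x : T * T) := (f x.1, f x.2).

Section EndPermutations.

Variables n s m : nat.
Local Notation V := 'I_n.+1.
Implicit Types (t : m.-tuple (V * V)) (h : {ffun 'I_s -> V}).
Implicit Types (sigma : {perm 'I_m}) (eps : {ffun 'I_m -> bool}).

Definition perm_ends sigma eps : {ffun ends s m -> ends s m} :=
  [ffun x => if x.1 is inl e then (inl (sigma e), x.2 (+) eps e) else x].

Lemma perm_endsE sigma eps e b :
  perm_ends sigma eps (inl e, b) = (inl (sigma e), b (+) eps e).
Proof. by rewrite ffunE. Qed.

Lemma perm_ends_inj sigma eps : injective (perm_ends sigma eps).
Proof.
case=> [[e|j] b] [[e'|j'] b']; rewrite !ffunE //= => -[] // /perm_inj -> /addIb ->.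
by [].
Qed.

Lemma perm_ends_edge sigma eps e :
  perm_ends sigma eps @: edge (inl e) = edge (inl (sigma e)).
Proof.
apply/eqP; rewrite eqEcard card_imset ?card_edge; last exact: perm_ends_inj.
rewrite leqnn andbT; apply/subsetP=> _ /imsetP[[i b] ib ->].
by move: ib; rewrite in_edge => /eqP /= ->; rewrite perm_endsE in_edge.
Qed.

Lemma perm_ends_ext_edge sigma eps j :
  perm_ends sigma eps @: edge (inr j) = edge (inr j).
Proof. by rewrite imsetU1 imset_set1 !ffunE. Qed.

Lemma is_iso_perm_ends (tau : {perm V}) sigma eps t h t' h' :
  (forall e, tnth t' (sigma e) = flip (eps e) (map_pair tau (tnth t e))) ->
  (forall j, h' j = tau (h j)) ->
  is_iso [ffun v => tau v] (perm_ends sigma eps) (lgraph t h) (lgraph t' h').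
Proof.
move=> tt' hh'; apply/is_isoP; split.
- by exists (tau^-1)%g => v; rewrite ffunE ?permK ?permKV.
- exact/injF_bij/perm_ends_inj.
- rewrite /Eint /= -imset_comp; apply/setP=> X; apply/imsetP/imsetP=> -[e _ ->].
    by exists (sigma e); rewrite //= perm_ends_edge.
  by exists ((sigma^-1)%g e); rewrite //= perm_ends_edge permKV.
- rewrite /Eext /= -imset_comp; apply: eq_imset => j /=.
  exact: perm_ends_ext_edge.
case=> [[e|j] b]; rewrite !place_lgraph !ffunE /=.
  by rewrite tt' ffunE; case: b; case: (eps e).
by case: b => //=; rewrite hh' ffunE.
Qed.

(** An isomorphism permutes the internal edges and may exchange the two ends of
    any of them, but it fixes the ends of the external edges, because their
    free ends carry distinct labels. *)
Lemma is_iso_lgraphP psiV psiK t h t' h' :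
  is_iso psiV psiK (lgraph t h) (lgraph t' h') ->
  exists tau : {perm V}, exists sigma, exists eps,
    [/\ psiV = [ffun v => tau v], psiK = perm_ends sigma eps,
        forall e, tnth t' (sigma e) = flip (eps e) (map_pair tau (tnth t e))
      & forall j, h' j = tau (h j)].
Proof.
case/is_isoP=> /bij_inj psiVI /bij_inj psiKI HI HE HP.
have /fin_all_exists[f fP] (e : 'I_m) :
    exists p : 'I_m * bool, forall b, psiK (inl e, b) = (inl p.1, b (+) p.2).
  have : psiK @: edge (inl e) \in Eint (lgraph t' h').
    by rewrite -HI; do 2!apply: imset_f.
  case/imsetP=> e' _ /setP E.
  have psiE b : (psiK (inl e, b)).1 = inl e'.
    by apply/eqP; rewrite -in_edge -E; apply: imset_f; rewrite in_edge.
  have psiD : (psiK (inl e, false)).2 != (psiK (inl e, true)).2.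
    apply/eqP=> D; have : psiK (inl e, false) = psiK (inl e, true).
      by rewrite [LHS]surjective_pairing [RHS]surjective_pairing !psiE D.
    by move/psiKI.
  exists (e', (psiK (inl e, false)).2) => b.
  rewrite [LHS]surjective_pairing psiE; congr pair; move: psiD.
  by case: b; case: (psiK (inl e, false)).2; case: (psiK (inl e, true)).2.
have fI : injective (fun e => (f e).1).
  move=> e e' ee'.
  have /psiKI : psiK (inl e, (f e').2) = psiK (inl e', (f e).2).
    by rewrite !fP ee' addbC.
  by case.
have psi_free j : psiK (inr j, true) = (inr j, true).
  have := HP (inr j, true); rewrite !place_lgraph !ffunE /=.
  by case: (psiK _) => [[e|l] b] //=; case: b => // -[->].
have psi_ext j b : psiK (inr j, b) = (inr j, b).
  case: b => //.
  have : psiK @: edge (inr j) \in Eext (lgraph t' h').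
    by rewrite -HE; do 2!apply: imset_f.
  case/imsetP=> l _ /setP E.
  have /eqP lj : inr j == inr l :> 'I_m + 'I_s.
    have := E (inr j, true); rewrite in_edge => <-; rewrite -psi_free.
    by apply: imset_f; rewrite in_edge.
  have : psiK (inr j, false) \in edge (inr l).
    by rewrite -E; apply: imset_f; rewrite in_edge.
  rewrite -lj in_edge => /eqP E1; rewrite [LHS]surjective_pairing E1.
  case E2 : (psiK _).2 => //.
  have : psiK (inr j, false) = psiK (inr j, true).
    by rewrite psi_free [LHS]surjective_pairing E1 E2.
  by move/psiKI.
exists (perm psiVI), (perm fI), [ffun e => (f e).2]; split.
- by apply/ffunP=> v; rewrite ffunE permE.
- by apply/ffunP=> -[[e|j] b]; rewrite ffunE /= ?psi_ext // permE ffunE fP.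
- move=> e; rewrite permE ffunE /flip /map_pair !permE.
  have := HP (inl e, true); have := HP (inl e, false).
  rewrite !fP !place_lgraph !ffunE /=.
  by case: (f e).2 => /= -[E1] -[E2]; rewrite -E1 -E2 -?surjective_pairing.
- move=> j; have := HP (inr j, false).
  by rewrite psi_ext !place_lgraph !ffunE permE /= => -[].
Qed.

End EndPermutations.

Section ClassEquations.

Variables n s : nat.
Local Notation V := 'I_n.+1.
Implicit Types (t : seq (V * V)) (h : {ffun 'I_s -> V}).

Lemma renaming_lgraph m (sigma : {perm 'I_m}) (eps : {ffun 'I_m -> bool})
    (t t' : m.-tuple (V * V)) h :
  (forall e, tnth t' (sigma e) = flip (eps e) (tnth t e)) ->
  class_of (lgraph t h) = class_of (lgraph t' h).
Proof.
move=> tt'; apply/class_ofP/existsP; exists (perm_ends s sigma eps).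
have := @is_iso_perm_ends n s m 1%g sigma eps t h t' h.
have -> : [ffun v => (1%g : {perm V}) v] = [ffun v => v].
  by apply/ffunP=> v; rewrite !ffunE perm1.
apply=> [e|j]; rewrite ?perm1 // tt'; congr flip.
by rewrite /map_pair !perm1 -surjective_pairing.
Qed.

Lemma cls_perm t t' h : perm_eq t t' -> cls t h = cls t' h.
Proof.
move=> pt; have st : size t == size t' by rewrite (perm_size pt).
rewrite (cls_tuple (Tuple st) h : cls t h = _).
have /tuple_permP[sigma E] : perm_eq (Tuple st) (in_tuple t') by [].
apply: (@renaming_lgraph _ sigma [ffun=> false]) => e; rewrite ffunE /=.
by rewrite (val_inj E : Tuple st = _) tnth_mktuple.
Qed.

Lemma cls_flip b x t h : cls (flip b x :: t) h = cls (x :: t) h.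
Proof.
apply: (@renaming_lgraph _ 1%g [ffun e => b && (e == ord0)]) => e.
rewrite perm1 ffunE; case: (unliftP ord0 e) => [j|] ->.
  by rewrite !(tnth_nth x) /= andbF.
by rewrite !(tnth_nth x) /= andbT; case: b; case: x.
Qed.

Lemma isomorphic_cls m (tau : {perm V}) (t : m.-tuple (V * V)) h :
  isomorphic (rep (cls t h))
    (rep (cls (map (map_pair tau) t) [ffun j => tau (h j)])).
Proof.
rewrite cls_tuple (cls_tuple [tuple of map (map_pair tau) t]).
apply: isomorphic_trans (renaming_isomorphic (renaming_symm (renaming_rep_class_of _))) _.
apply: isomorphic_trans _ (renaming_isomorphic (renaming_rep_class_of _)).
apply/existsP; exists [ffun v => tau v].
apply/existsP; exists (perm_ends s 1%g [ffun=> false]).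
by apply: is_iso_perm_ends => [e|j]; rewrite ffunE ?tnth_map ?perm1.
Qed.

Lemma cls_add_edge m (t : m.-tuple (V * V)) h i j :
  class_of (add_edge i j (lgraph t h)) = cls ((i, j) :: t) h.
Proof.
rewrite (cls_tuple [tuple of (i, j) :: t]); apply/class_ofP.
pose f (x : ends s m + bool) : ends s m.+1 :=
  match x with
  | inl (inl e, b) => (inl (lift ord0 e), b)
  | inl (inr j, b) => (inr j, b)
  | inr b => (inl ord0, b)
  end.
pose g (x : ends s m.+1) : ends s m + bool :=
  match x with
  | (inl e, b) => if unlift ord0 e is Some e' then inl (inl e', b) else inr b
  | (inr j, b) => inl (inr j, b)
  end.
have fK : cancel f g.
  by case=> [[[e|l] b]|b] //=; rewrite ?liftK ?unlift_none.
have gK : cancel g f.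
  by case=> [[e|l] b] //=; case: unliftP => [e'|] ->.
pose F : {ffun ends s m + bool -> ends s m.+1} := [ffun x => f x].
have Finl (e : 'I_m) : F @: (inl @: edge (inl e)) = edge (inl (lift ord0 e)).
  by rewrite /edge !imsetU1 !imset_set1 !ffunE.
have Finr (l : 'I_s) : F @: (inl @: edge (inr l)) = edge (inr l).
  by rewrite /edge !imsetU1 !imset_set1 !ffunE.
apply/existsP; exists F; apply/is_isoP; split.
- exact/bijectivebP/bijectiveb_id.
- by exists g => x; rewrite ffunE ?fK ?gK.
- rewrite /Eint /= imsetU1; apply/setP=> X; rewrite !inE.
  rewrite imsetU1 imset_set1 !ffunE /=; apply/orP/imsetP=> [[/eqP ->|]|[e _ ->]].
  + by exists ord0.
  + case/imsetP=> _ /imsetP[_ /imsetP[e _ ->] ->] ->.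
    by exists (lift ord0 e); rewrite ?Finl.
  + case: (unliftP ord0 e) => [e'|] ->; [right | by left].
    by rewrite -Finl; do 3!apply: imset_f.
- rewrite /Eext /= -!imset_comp; apply: eq_imset => l /=; exact: Finr.
case=> [[[e|l] b]|b]; rewrite /place /= !ffunE /=.
- by rewrite ffunE tnthS.
- by case: b; rewrite //= ffunE.
- by rewrite ffunE; case: b.
Qed.

End ClassEquations.

Section Numbering.

Variables n s : nat.
Local Notation V := 'I_n.+1.

(** The ends are numbered by choosing, for every internal edge, an order of its
    two ends and, for every label, the external edge whose free end carries it. *)
Lemma renaming_lgraph_exists (K : finType) (G : graph V K s) :
  exists (t : #|Eint G|.-tuple (V * V)) (h : {ffun 'I_s -> V}),
    renaming (lgraph t h) G.
Proof.
have /and5P[_ dIE /and3P[/eqP cov triv _] c2 /and3P[hI hE hS]] :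
  is_graph (Eint G, Eext G, place G) by case: (G) => -[[? ?] ?].
have same A B x : A \in Eint G :|: Eext G -> B \in Eint G :|: Eext G ->
    x \in A -> x \in B -> A = B.
  move=> AG BG xA xB; apply/eqP; apply: contraT => AB.
  by have /pred0P/(_ x) := trivIsetP triv A B AG BG AB; rewrite /= xA xB.
have free_uniq j x y : place G x = inr j -> place G y = inr j -> x = y.
  have /cards1P[z E] := forallP hS j => xj yj.
  have : x \in [set z] by rewrite -E inE xj.
  have : y \in [set z] by rewrite -E inE yj.
  by rewrite !inE => /eqP-> /eqP->.
have /fin_all_exists[p pP] (i : 'I_#|Eint G| + 'I_s) : exists p : K * K,
    p.1 != p.2 /\ match i with
                  | inl e => enum_val e = [set p.1; p.2]
                  | inr j => [/\ [set p.1; p.2] \in Eext G, place G p.2 = inr j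
                                 & ~~ is_free (place G p.1)]
                  end.
  case: i => [e|j].
    have eG := enum_valP e.
    have /cards2P[x [y [xy E]]] : #|enum_val e| == 2.
      by apply: (forall_inP c2); rewrite inE eG.
    by exists (x, y).
  have /cards1P[y Ey] := forallP hS j.
  have yj : place G y = inr j.
    by apply/eqP; have := set11 y; rewrite -Ey inE.
  have /bigcupP[A AG yA] : y \in cover (Eint G :|: Eext G) by rewrite cov.
  have AE : A \in Eext G.
    case/setUP: (AG) => // AI.
    by have := forall_inP (forall_inP hI A AI) y yA; rewrite yj.
  have /cards1P[z Ez] := forall_inP hE A AE.
  have yz : y = z by apply/eqP; rewrite -in_set1 -Ez inE yA yj.
  have /cards2P[a [b [ab EA]]] := forall_inP c2 A AG.
  have {a b ab EA} [a [ay EA]] : exists a, a != y /\ A = [set a; y].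
    move: (yA); rewrite EA !inE => /orP[]/eqP ->; last by exists a.
    by exists b; rewrite eq_sym setUC.
  exists (a, y); split=> //; split; rewrite /= -?EA //.
  apply: contra ay => fa; rewrite yz -in_set1 -Ez inE fa andbT EA.
  by rewrite !inE eqxx.
pose S i := [set (p i).1; (p i).2].
have SG i : S i \in Eint G :|: Eext G.
  rewrite inE; case: (pP i) => _; rewrite /S; case: i => [e <-|j [-> _ _]].
    by rewrite enum_valP.
  by rewrite orbT.
have SE i : S i \in Eext G = if i is inl _ then false else true.
  case: i => [e|j]; last by case: (pP (inr j)) => _ [].
  case: (pP (inl e)) => _; rewrite /S => <-; apply/negP=> eE.
  by have /pred0P/(_ (enum_val e)) := dIE; rewrite /= eE enum_valP.
have SI : injective S.
  move=> i i' ii'; have := SE i; have := SE i'; rewrite ii'.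
  case: i i' ii' => [e|j] [e'|j'] ii' => [_ _|->|->|_ _] //.
    case: (pP (inl e)) (pP (inl e')) => _ Ee [_ Ee'].
    by congr inl; apply: enum_val_inj; rewrite Ee Ee'.
  case: (pP (inr j)) (pP (inr j')) => _ [_ fj _] [_ [_ fj' nj']].
  have : (p (inr j)).2 \in S (inr j') by rewrite -ii' !inE eqxx orbT.
  rewrite !inE => /orP[]/eqP E; first by rewrite -E fj in nj'.
  by move: fj; rewrite E fj' => -[->].
pose f (x : ends s #|Eint G|) := if x.2 then (p x.1).2 else (p x.1).1.
have fS x : f x \in S x.1.
  by rewrite /f /S !inE; case: x.2; rewrite eqxx ?orbT.
have fI : injective f.
  move=> x y fxy; have xy : x.1 = y.1.
    by apply: SI; apply: (same _ _ (f x)) => //; rewrite fxy.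
  rewrite [x]surjective_pairing [y]surjective_pairing xy; congr pair.
  case: (pP y.1) => /negP + _; move: fxy; rewrite /f xy.
  by case: x.2; case: y.2 => // ->; rewrite eqxx.
have fS' x i : x \in S i -> exists y, f y = x.
  by rewrite !inE => /orP[]/eqP ->; [exists (i, false) | exists (i, true)].
have fsurj x : exists y, f y = x.
  have /bigcupP[A AG xA] : x \in cover (Eint G :|: Eext G) by rewrite cov.
  case/setUP: (AG) => AE.
    apply: (fS' x (inl (enum_rank_in AE A))).
    by case: (pP (inl (enum_rank_in AE A))) => _; rewrite /S => <-; rewrite enum_rankK_in.
  have /cards1P[y Ey] := forall_inP hE A AE.
  have := set11 y; rewrite -Ey inE; case yE: (place G y) => [v|j] /andP[yA] //= _.
  apply: (fS' x (inr j)); case: (pP (inr j)) => _ [_ fj _].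
  suff -> : S (inr j) = A by [].
  by apply: (same _ _ y) => //; rewrite (free_uniq j y (p (inr j)).2) // !inE eqxx orbT.
pose psiK : {ffun ends s #|Eint G| -> K} := [ffun x => f x].
have psiS i : psiK @: edge i = S i.
  by rewrite imsetU1 imset_set1 !ffunE.
pose vert (z : V + 'I_s) := if z is inl v then v else ord0.
(* The value [ord0] of [vert] at free ends is a default that does not occur. *)
exists [tuple (vert (place G (p (inl e)).1), vert (place G (p (inl e)).2)) | e < #|Eint G|].
exists [ffun j => vert (place G (p (inr j)).1)].
apply/existsP; exists psiK; apply/is_isoP; split.
- exact/bijectivebP/bijectiveb_id.
- have [g gP] := fin_all_exists fsurj.
  by exists g => x; [apply: fI |]; rewrite ffunE gP // ffunE.
- rewrite {1}/Eint /= -imset_comp; apply/setP=> A; apply/imsetP/idP.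
    case=> e _ ->; rewrite /= psiS /S; case: (pP (inl e)) => _ <-; exact: enum_valP.
  move=> AE; exists (enum_rank_in AE A) => //=; rewrite psiS /S.
  by case: (pP (inl (enum_rank_in AE A))) => _ <-; rewrite enum_rankK_in.
- rewrite {1}/Eext /= -imset_comp; apply/setP=> A; apply/imsetP/idP.
    by case=> j _ ->; rewrite /= psiS SE.
  move=> AE; have AG : A \in Eint G :|: Eext G by rewrite inE AE orbT.
  have /cards1P[y Ey] := forall_inP hE A AE.
  have := set11 y; rewrite -Ey inE; case yE: (place G y) => [v|j] /andP[yA] //= _.
  exists j; rewrite //= psiS; case: (pP (inr j)) => _ [_ fj _].
  by apply: (same _ _ y) => //; rewrite (free_uniq j y (p (inr j)).2) // !inE eqxx orbT.
case=> [[e|j] b]; rewrite place_lgraph !ffunE /= /f /=.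
  have : ~~ is_free (place G (if b then (p (inl e)).2 else (p (inl e)).1)).
    apply: (forall_inP (forall_inP hI (S (inl e)) _)).
      by have := SG (inl e); rewrite inE SE orbF.
    by rewrite /S !inE; case: b; rewrite eqxx ?orbT.
  rewrite tnth_mktuple /=; case: b => /=;
    by case: (place G _) => //= v _; rewrite ffunE.
case: (pP (inr j)) => _ [_ fj]; case: b => /=; first by rewrite fj.
by rewrite !ffunE; case: (place G _).
Qed.

Lemma clsP (G : vgraph n.+1 s) : exists t h, G = cls t h.
Proof.
have [t [h /class_ofP E]] := renaming_lgraph_exists (rep G).
by exists (val t), h; rewrite cls_tuple E class_of_rep.
Qed.

End Numbering.

(** * Counting the numberings of a graph *)

Section Counting.

Variables n s m : nat.
Local Notation V := 'I_n.+1.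
Local Notation lab := (m.-tuple (V * V) * {ffun 'I_s -> V})%type.

(** The pairs of a numbered graph and an isomorphism from it to the given one are
    counted twice.  Every numbered graph in the class has as many isomorphisms as
    the symmetry factor.  On the other hand a permutation of the vertices, a
    permutation of the edges and a set of edges to reverse determine both the
    isomorphism and the graph from which it starts. *)
Lemma card_numberings (t0 : m.-tuple (V * V)) h0 :
  (#|[set p : lab | isomorphic (lgraph p.1 p.2) (lgraph t0 h0)]|
     * symmetry_factor (lgraph t0 h0) = n.+1`! * m`! * 2 ^ m)%N.
Proof.
pose g0 := lgraph t0 h0.
pose X := [set q : lab * ({ffun V -> V} * {ffun ends s m -> ends s m}) |
            is_iso q.2.1 q.2.2 (lgraph q.1.1 q.1.2) g0].
have -> : (#|[set p : lab | isomorphic (lgraph p.1 p.2) (lgraph t0 h0)]|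
     * symmetry_factor (lgraph t0 h0) = #|X|)%N.
  rewrite -[RHS]sum1_card (eq_bigl (fun q => true &&
    (q.2 \in isos (lgraph q.1.1 q.1.2) g0))); last by move=> q; rewrite !inE.
  rewrite -(pair_big_dep xpredT (fun p psi => psi \in isos (lgraph p.1 p.2) g0)
    (fun _ _ => 1%N)) /= -sum_nat_const big_mkcond.
  apply: eq_bigr => p _; rewrite inE sum1_card; case: ifP => [iso|niso].
    by rewrite symmetry_factorE; apply/card_isos/isomorphic_refl/isomorphic_sym.
  apply/esym/eqP; rewrite cards_eq0; apply/eqP/setP=> psi; rewrite !inE.
  apply: contraFF niso => psiP; apply/existsP; exists psi.1.
  by apply/existsP; exists psi.2.
pose F (a : {perm V} * {perm 'I_m} * {ffun 'I_m -> bool}) :=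
  let: (tau, sigma, eps) := a in
  let t' := [tuple map_pair (tau^-1)%g (flip (eps e) (tnth t0 (sigma e))) | e < m] in
  ((t', [ffun j => (tau^-1)%g (h0 j)]), ([ffun v => tau v], perm_ends s sigma eps)).
have FI : injective F.
  case=> [[tau sigma] eps] [[tau' sigma'] eps'] [_ _ /ffunP E1 /ffunP E2].
  have -> : tau = tau' by apply/permP=> v; have := E1 v; rewrite !ffunE.
  have E e := E2 (inl e, false); congr (_, _, _).
    by apply/permP=> e; have := E e; rewrite !perm_endsE => -[].
  by apply/ffunP=> e; have := E e; rewrite !perm_endsE => -[].
have -> : X = F @: setT.
  apply/setP=> -[[t h] [psiV psiK]]; rewrite inE /=.
  apply/idP/imsetP=> [/is_iso_lgraphP|[[[tau sigma] eps] _ [-> -> -> ->]]].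
    case=> tau [sigma [eps [-> -> tt0 hh0]]].
    exists (tau, sigma, eps); rewrite //; congr (_, _, _).
      apply: eq_from_tnth => e; rewrite tnth_mktuple tt0.
      by case: (tnth t e) => a b; case: (eps e); rewrite /flip /map_pair /= !permK.
    by apply/ffunP=> j; rewrite ffunE hh0 permK.
  apply: is_iso_perm_ends => [e|j]; last by rewrite ffunE permKV.
  rewrite tnth_mktuple.
  by case: (tnth _ _) => a b; case: (eps e); rewrite /flip /map_pair /= !permKV.
rewrite card_imset // cardsT !card_prod card_ffun card_bool.
by rewrite !card_Sn card_ord.
Qed.

End Counting.

(** * Merging the last vertex into another one *)

Definition between (T : eqType) (a x : T * T) := (x == a) || (x == (a.2, a.1)).

Section Merge.

Variable n : nat.
Local Notation V := 'I_n.+1.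
Local Notation W := 'I_n.+2.

Definition emb : V -> W := widen_ord (leqnSn n.+1).

(** The last vertex is the one that a splitting creates, so this map undoes the
    splitting of [i]. *)
Definition merge_last (i : V) (v : W) : V := insubd i (val v).

Lemma embK i : cancel emb (merge_last i).
Proof. by move=> j; apply: val_inj; rewrite /merge_last val_insubd /= ltn_ord. Qed.

Lemma merge_max i : merge_last i ord_max = i.
Proof. by apply: val_inj; rewrite /merge_last val_insubd /= ltnn. Qed.

Lemma emb_inj : injective emb.
Proof. exact: can_inj (embK ord0). Qed.

Lemma emb_neq_max j : (emb j == ord_max) = false.
Proof. by apply/eqP=> /(congr1 val) /= jn; have := ltn_ord j; rewrite jn ltnn. Qed.

Variant emb_spec : W -> Type :=
  | EmbMax : emb_spec ord_max
  | EmbOld j : emb_spec (emb j).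

Lemma embP v : emb_spec v.
Proof.
case: (ltnP v n.+1) => vn; last first.
  have -> : v = ord_max by apply: val_inj => /=; have := ltn_ord v; lia.
  exact: EmbMax.
have -> : v = emb (Ordinal vn) by apply: val_inj.
exact: EmbOld.
Qed.

Variable i : V.
Local Notation a := (emb i, @ord_max n.+1).

Lemma eq_merge v w :
  (merge_last i v == merge_last i w) = (v == w) || between a (v, w).
Proof.
have maxN j : (ord_max == emb j) = false by rewrite eq_sym emb_neq_max.
rewrite /between /= !xpair_eqE; case: (embP v) => [|j]; case: (embP w) => [|l];
  rewrite ?merge_max ?embK ?eqxx ?emb_neq_max ?maxN ?andbF ?orbF ?andbT //=.
by rewrite (inj_eq emb_inj) eq_sym.
Qed.

Lemma all_loopless_merge t :
  all (fun e => e.1 != e.2) (map (map_pair (merge_last i)) t) =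
  all (fun e => e.1 != e.2) t && all (predC (between a)) t.
Proof.
rewrite all_map -all_predI; apply: eq_all => -[v w] /=.
by rewrite eq_merge negb_or.
Qed.

(** The image of a path under the merging is a path with possibly stationary
    steps.  Conversely a path lifts, because the two vertices above [i] are joined
    by one of the [rho] edges. *)
Lemma connected_merge rho t : (0 < rho)%N ->
  [forall v, forall w, connect (joined (map (map_pair (merge_last i)) t)) v w] =
  [forall v, forall w, connect (joined (nseq rho a ++ t)) v w].
Proof.
case: rho => // rho _; set u := nseq _ _ ++ t; set t' := map _ t.
have symu : connect_sym (joined u).
  by apply: sym_connect_sym => v w; rewrite /joined orbC.
have emb_merge v : connect (joined u) v (emb (merge_last i v)).
  case: (embP v) => [|j]; last by rewrite embK connect0.
  by rewrite merge_max symu connect1 // /joined /u /= inE eqxx.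
have conn_merge v w : merge_last i v = merge_last i w -> connect (joined u) v w.
  by move=> vw; apply: connect_trans (emb_merge v) _; rewrite vw symu.
apply/idP/idP=> /forallP ct; apply/forallP=> v; apply/forallP=> w.
  have /connectP[p] := forallP (ct (merge_last i v)) (merge_last i w).
  elim: p v => [|x p IH] v /=; first by move=> _ /esym; apply: conn_merge.
  case/andP=> vx xp wE.
  have [y yx vy] : exists2 y, merge_last i y = x & connect (joined u) v y.
    case/orP: vx => /mapP[[b c] bct] [E1 E2].
      exists c => //; apply: connect_trans (conn_merge _ _ E1) _.
      by rewrite connect1 // /joined mem_cat bct orbT.
    exists b => //; apply: connect_trans (conn_merge _ _ E2) _.
    by rewrite symu connect1 // /joined mem_cat bct orbT.
  by apply: connect_trans vy (IH _ _ _); rewrite yx.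
rewrite -(embK i v) -(embK i w).
have /connectP[p] := forallP (ct (emb v)) (emb w).
elim: p (emb v) => [|x p IH] z /=; first by move=> _ ->.
case/andP=> zx xp /(IH _ xp); apply: connect_trans.
have mE b c : (b, c) \in u ->
    (merge_last i b == merge_last i c) || joined t' (merge_last i b) (merge_last i c).
  rewrite mem_cat => /orP[|bct]; last first.
    by rewrite /joined (map_f (map_pair (merge_last i)) bct) orbT.
  by rewrite mem_nseq => /andP[_ /eqP[-> ->]]; rewrite embK merge_max eqxx.
have : (merge_last i z == merge_last i x) || joined t' (merge_last i z) (merge_last i x).
  by case/orP: zx => /mE //; rewrite eq_sym /joined [X in _ || X]orbC.
by case/orP=> [/eqP->|]; [exact: connect0 | exact: connect1].
Qed.

(** An edge of [t] parallel to the merged ones would become a loop. *)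
Lemma conn_loopless_merge rho t : (0 < rho)%N ->
  conn_loopless (map (map_pair (merge_last i)) t) =
  conn_loopless (nseq rho a ++ t) && all (predC (between a)) t.
Proof.
move=> rho0; rewrite /conn_loopless all_loopless_merge (connected_merge _ rho0).
rewrite all_cat all_nseq emb_neq_max orbT /=.
by rewrite -!andbA; congr andb; rewrite andbC.
Qed.

End Merge.

(** The functions of a list of oriented edges that depend only on the multiset
    of the underlying unoriented edges. *)
Definition edge_invariant (T : eqType) (A : Type) (F : seq (T * T) -> A) : Prop :=
  (forall t t', perm_eq t t' -> F t = F t') /\
  (forall b x t, F (flip b x :: t) = F (x :: t)).

Lemma edge_invariant_flips (T : eqType) (A : Type) (F : seq (T * T) -> A) a bs t :
  edge_invariant F -> F ([seq flip b a | b <- bs] ++ t) = F (nseq (size bs) a ++ t).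
Proof.
move=> [Fp Ff]; elim: bs t => //= b bs IH t; rewrite Ff -!cat_cons.
have E c r : perm_eq (c :: r ++ t) (r ++ c :: t) by rewrite -cat1s perm_catCA.
by rewrite (Fp _ _ (E _ _)) IH -(Fp _ _ (E _ _)).
Qed.

Lemma edge_invariant_conn_loopless (V : finType) :
  edge_invariant (@conn_loopless V).
Proof.
split=> [t t' pt|b x t]; rewrite /conn_loopless.
  rewrite (perm_all _ pt); congr andb.
  apply/eq_forallb=> v; apply/eq_forallb=> w.
  by apply: eq_connect => x y; rewrite /joined !(perm_mem pt).
congr andb; first by case: b x => -[v w] //=; rewrite eq_sym.
apply/eq_forallb=> v; apply/eq_forallb=> w.
apply: eq_connect => y z; case: b x => -[c d] //=.
rewrite /joined !inE !xpair_eqE /=.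
by case: (y == c); case: (z == d); case: (y == d); case: (z == c); rewrite ?orbT.
Qed.

Lemma edge_invariant_cls n s (h : {ffun 'I_s -> 'I_n.+1}) :
  edge_invariant (fun t => cls t h).
Proof. by split=> [t t' /cls_perm|b x t]; [apply | apply: cls_flip]. Qed.

(** The edges parallel to [a] can be recorded by their orientations relative to
    [a], which an [edge_invariant] function does not see. *)
Lemma split_parallel (T : eqType) (a : T * T) (t : seq (T * T)) :
  exists2 t1, all (predC (between a)) t1 &
    exists2 bs : seq bool, size bs = count (between a) t &
      perm_eq t ([seq flip b a | b <- bs] ++ t1).
Proof.
exists (filter (predC (between a)) t); first exact: filter_all.
exists (map (fun x => x != a) (filter (between a) t)).
  by rewrite size_map size_filter.
have -> : [seq flip b a | b <- [seq x != a | x <- t & between a x]] =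
          filter (between a) t.
  rewrite -map_comp -[RHS]map_id; apply/eq_in_map => x; rewrite mem_filter.
  by case/andP=> /orP[]/eqP-> _ /=; rewrite /flip; case: eqP.
by rewrite perm_sym (perm_filterC (between a) t).
Qed.

(** The first step of a path from the last vertex to another one leaves the last
    vertex, because there are no loops. *)
Lemma conn_loopless_neighbour n (t : seq ('I_n.+2 * 'I_n.+2)) :
  conn_loopless t -> exists i, has (between (emb i, ord_max)) t.
Proof.
case/andP=> lt /forallP ct.
have /connectP[[|v p] /=] := forallP (ct ord_max) (emb ord0).
  by move=> _ /eqP; rewrite emb_neq_max.
case/andP=> mv _ _; move: mv; case: (embP v) => [|i] mv.
  by case/orP: mv => /(allP lt) /=; rewrite eqxx.
exists i; apply/hasP; case/orP: mv => e; eexists; try exact: e;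
  by rewrite /between eqxx ?orbT.
Qed.

(** Merging the last vertex into a neighbour removes one vertex and at least one
    edge. *)
Lemma conn_loopless_size n (t : seq ('I_n.+1 * 'I_n.+1)) :
  conn_loopless t -> (n <= size t)%N.
Proof.
elim: n t => // n IH t ct; have [i it] := conn_loopless_neighbour ct.
have [t1 t1P [bs sbs pt]] := split_parallel (emb i, ord_max) t.
have bs0 : (0 < size bs)%N by rewrite sbs -has_count.
have inv := edge_invariant_conn_loopless 'I_n.+2.
have /IH : conn_loopless (map (map_pair (merge_last i)) t1).
  rewrite (conn_loopless_merge _ _ bs0) t1P andbT -edge_invariant_flips //.
  by rewrite -(inv.1 _ _ pt).
rewrite size_map (perm_size pt) size_cat size_map => nt1.
exact: (leq_add bs0 nt1).
Qed.

(** * Sums over lists of edges *)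

Local Open Scope ring_scope.

Lemma sum_tuple_cons (T : finType) (R : nmodType) m (F : seq T -> R) :
  \sum_(t : m.+1.-tuple T) F t = \sum_x \sum_(t : m.-tuple T) F (x :: t).
Proof.
rewrite pair_big /=.
rewrite (reindex (fun p : T * m.-tuple T => [tuple of p.1 :: p.2])) //=.
exists (fun t => (thead t, [tuple of behead t])) => [[x t]|t] _ /=.
  by congr pair; apply: val_inj.
by rewrite -tuple_eta.
Qed.

Lemma edge_invariant_cons (T : eqType) (A : Type) (F : seq (T * T) -> A) x :
  edge_invariant F -> edge_invariant (fun t => F (x :: t)).
Proof.
case=> Fp Ff; split=> [t t' tt'|b y t]; first by apply: Fp; rewrite perm_cons.
have E z r : perm_eq (x :: z :: r) (z :: x :: r) by rewrite (perm_catCA [:: x] [:: z]).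
by rewrite (Fp _ _ (E _ _)) Ff -(Fp _ _ (E _ _)).
Qed.

Section ParallelEdges.

Variables (T : finType) (R : pzRingType) (a : T * T).
Hypothesis a_loopless : a.1 != a.2.
Implicit Types F : seq (T * T) -> R.

(** The [r] edges parallel to [a] have ['C(m, r)] possible sets of positions, and
    each of them has two orientations, neither of which changes the value of
    [F]. *)
Lemma sum_count_between m r F : edge_invariant F ->
  \sum_(t : m.-tuple (T * T) | count (between a) t == r) F t =
  \sum_(t : (m - r).-tuple (T * T) | all (predC (between a)) t)
     F (nseq r a ++ t) *+ ('C(m, r) * 2 ^ r).
Proof.
have card2 (x : R) : \sum_(y | between a y) x = x *+ 2.
  rewrite sumr_const; congr (_ *+ _); rewrite (eq_card (B := [set a; (a.2, a.1)])).
    by rewrite cards2 (contra _ a_loopless) // => /eqP E; rewrite {1}E.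
  by move=> y; rewrite !inE.
elim: m r F => [|m IH] r F Finv.
  rewrite big_mkcond (big_pred1 [tuple]) => [|t]; last by rewrite [t]tuple0 /= eqxx.
  case: r => [|r] /=; last by rewrite big1 // => t _; rewrite mul0n mulr0n.
  rewrite big_mkcond (big_pred1 [tuple]) => [|t]; last by rewrite [t]tuple0 /= eqxx.
  by rewrite /= muln1.
rewrite big_mkcond (sum_tuple_cons m (fun t =>
  if count (between a) t == r then F t else 0)).
rewrite (bigID (between a)) /=.
have -> : \sum_(x | between a x) \sum_(t : m.-tuple (T * T))
    (if (between a x + count (between a) t)%N == r then F (x :: t) else 0) =
  (\sum_(t : m.-tuple (T * T) | (count (between a) t).+1 == r) F (a :: t)) *+ 2.
  rewrite -card2; apply: eq_bigr => x ax; rewrite [RHS]big_mkcond; apply: eq_bigr => t _.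
  rewrite ax add1n; case: ifP => // _.
  have -> : x = flip (x != a) a.
    by case/orP: ax => /eqP -> /=; rewrite /flip; case: eqP.
  by rewrite Finv.2.
have -> : \sum_(x | ~~ between a x) \sum_(t : m.-tuple (T * T))
    (if (between a x + count (between a) t)%N == r then F (x :: t) else 0) =
  \sum_(x | ~~ between a x) \sum_(t : (m - r).-tuple (T * T) | all (predC (between a)) t)
     F (x :: nseq r a ++ t) *+ ('C(m, r) * 2 ^ r).
  apply: eq_bigr => x /negbTE ax.
  rewrite -(IH r (fun t => F (x :: t))); last exact: edge_invariant_cons.
  by rewrite [RHS]big_mkcond; apply: eq_bigr => t _; rewrite ax.
have step r' :
  \sum_(x | ~~ between a x) \sum_(t : r'.-tuple (T * T) | all (predC (between a)) t)
     F (x :: nseq r a ++ t) =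
  \sum_(t : r'.+1.-tuple (T * T) | all (predC (between a)) t) F (nseq r a ++ t).
  rewrite [RHS]big_mkcond (sum_tuple_cons r' (fun t =>
    if all (predC (between a)) t then F (nseq r a ++ t) else 0)).
  rewrite big_mkcond; apply: eq_bigr => x _ /=.
  case: (between a x) => /=; first by rewrite big1.
  rewrite big_mkcond; apply: eq_bigr => t _; case: ifP => // _.
  apply: Finv.1; apply/permPl; exact: (perm_catCA [:: x] (nseq r a) t).
have -> k : \sum_(x | ~~ between a x)
      \sum_(t : (m - r).-tuple (T * T) | all (predC (between a)) t)
        F (x :: nseq r a ++ t) *+ k =
    (\sum_(t : (m - r).+1.-tuple (T * T) | all (predC (between a)) t)
       F (nseq r a ++ t)) *+ k.
  by rewrite -step -sumrMnl; apply: eq_bigr => x _; rewrite sumrMnl.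
rewrite sumrMnl; case: r {step} => [|r].
  by rewrite big_pred0 ?mul0rn ?add0r ?bin0 ?subn0.
rewrite subSS (IH r (fun t => F (a :: t))); last exact: edge_invariant_cons.
rewrite sumrMnl -mulrnA -mulnA -expnSr binS mulnDl mulrnDr [LHS]addrC.
congr (_ + _); have [rm|mr] := ltnP r m; first by rewrite subnSK.
by rewrite bin_small // !mul0n !mulr0n.
Qed.

(** The weight [count (between a) t] is what the factors 1 / (rho - 1)! of the
    recursion amount to after normalization. *)
Lemma sum_count_between_weighted m F : edge_invariant F ->
  \sum_(t : m.-tuple (T * T)) F t *+ count (between a) t =
  \sum_(1 <= r < m.+1)
    (\sum_(t : (m - r).-tuple (T * T) | all (predC (between a)) t)
       F (nseq r a ++ t)) *+ (r * ('C(m, r) * 2 ^ r)).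
Proof.
move=> Finv.
have -> : \sum_(t : m.-tuple (T * T)) F t *+ count (between a) t =
    \sum_(0 <= r < m.+1)
      \sum_(t : m.-tuple (T * T) | count (between a) t == r) F t *+ r.
  rewrite big_mkord; under [RHS]eq_bigr => r _ do rewrite big_mkcond.
  rewrite exchange_big; apply: eq_bigr => t _ /=.
  have tm : (count (between a) t < m.+1)%N by rewrite ltnS -[leqRHS](size_tuple t) count_size.
  rewrite (bigD1 (Ordinal tm)) //= eqxx big1 ?addr0 // => r rt.
  by case: eqP => // E; case/eqP: rt; apply: val_inj.
rewrite big_nat_recl // [X in X + _]big1 ?add0r; last by move=> t _; rewrite mulr0n.
rewrite [RHS]big_add1; apply: eq_bigr => r _.
by rewrite sumrMnl (sum_count_between _ _ Finv) sumrMnl -mulrnA mulnC.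
Qed.

End ParallelEdges.

(** * The operators on numbered graphs *)

Section FreegLinear.

Variables (R : nzRingType) (K : choiceType) (M : lmodType R) (f : K -> M).

HB.instance Definition _ :=
  GRing.isAdditive.Build {freeg K / R} M (fglift f) (lift_is_additive f).

Lemma fgliftE (D : {freeg K / R}) :
  fglift f D = \sum_(x <- dom D) coeff x D *: f x.
Proof.
rewrite -[D in LHS]freeg_sumE raddf_sum.
by apply: eq_bigr => x _; rewrite /= liftU.
Qed.

Lemma fglift_scalable : scalable (fglift f).
Proof.
move=> c D; rewrite -[D]freeg_sumE scaler_sumr !raddf_sum /=.
apply: eq_bigr => x _.
have -> : c *: << coeff x D *g x >> = << (c * coeff x D) *g x >> :> {freeg K / R}.
  by apply/eqP/freeg_eqP => y; rewrite coeffZ !coeffU mulrA.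
by rewrite !liftU scalerA.
Qed.

HB.instance Definition _ :=
  GRing.isScalable.Build R {freeg K / R} M *:%R (fglift f) fglift_scalable.

End FreegLinear.

Section Operators.

Variables n s : nat.
Local Notation V := 'I_n.+1.
Local Notation W := 'I_n.+2.

Definition merge_lab m (i : V) (p : m.-tuple (W * W) * {ffun 'I_s -> W}) :
    m.-tuple (V * V) * {ffun 'I_s -> V} :=
  ([tuple of map (map_pair (merge_last i)) p.1], [ffun j => merge_last i (p.2 j)]).

(** A splitting is determined by the set of ends that are moved to the new vertex,
    and these are the ends at the last vertex of the resulting numbered graph. *)
Lemma s_cls m (i : V) (t : m.-tuple (V * V)) h :
  s_ i << cls t h >> =
  \sum_(p | merge_lab i p == (t, h)) << cls p.1 p.2 >>.
Proof.
rewrite cls_tuple s_class_of.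
(* [F'] lifts the given numbered graph along a choice of ends, [F] reads the
   choice off the last vertex of a lift. *)
pose up (A : {set ends s m}) x (v : V) := if x \in A then ord_max else emb v.
pose G := lgraph t h.
pose F (p : m.-tuple (W * W) * {ffun 'I_s -> W}) :=
  let A := [set x | place (lgraph p.1 p.2) x == inl ord_max] in
  (ends_at G i :\: A, A).
pose F' (E : {set ends s m} * {set ends s m}) :
    m.-tuple (W * W) * {ffun 'I_s -> W} :=
  ([tuple (up E.2 (inl e, false) (tnth t e).1,
           up E.2 (inl e, true) (tnth t e).2) | e < m],
   [ffun j => up E.2 (inr j, false) (h j)]).
have F'E E : lgraph (F' E).1 (F' E).2 = split_vertex E.2 G.
  apply: val_inj; rewrite /= /Eint /Eext /=; congr (_, _, _).
  apply/ffunP=> -[[e|j] b]; rewrite !ffunE /=; last by case: b; rewrite //= ffunE.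
  by rewrite tnth_mktuple; case: b.
have upK E x v : E.1 :|: E.2 == ends_at G i -> place G x = inl v ->
    merge_last i (up E.2 x v) = v.
  move=> /eqP/setP/(_ x) EE xv; rewrite /up; case: ifP => xE; rewrite ?embK //.
  by move: EE; rewrite !inE xE orbT xv merge_max => /esym /eqP[].
have place_merge p x : merge_lab i p = (t, h) ->
    place G x = map_vertex (merge_last i) (place (lgraph p.1 p.2) x).
  rewrite /G => -[<- <-]; rewrite !place_lgraph !ffunE /=; case: x => [[e|j] b] /=.
    by rewrite tnth_map; case: b.
  by case: b; rewrite //= ffunE.
rewrite (reindex_onto F F') => [|[E1 E2]] /=.
  apply: eq_big => [p|p /andP[_ /eqP pE]]; last first.
    by rewrite -[in RHS]pE cls_tuple F'E.
  apply/andP/eqP=> [[/andP[_ EE] /eqP <-]|pE].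
    congr (_, _).
      apply: eq_from_tnth => e; rewrite tnth_map tnth_mktuple /map_pair /=.
      rewrite [RHS]surjective_pairing.
      by congr (_, _); apply: (upK (F p)); rewrite // place_lgraph ffunE.
    by apply/ffunP=> j; rewrite !ffunE; apply: (upK (F p)); rewrite // place_lgraph ffunE.
  have upM x w : place (lgraph p.1 p.2) x = inl w ->
      up (F p).2 x (merge_last i w) = w.
    rewrite /up inE => ->; case: (embP w) => [|j]; first by rewrite eqxx.
    by rewrite embK (emb_neq_max j : (inl (emb j) == inl ord_max :> W + 'I_s) = false).
  split.
    apply/andP; split.
      by rewrite -setI_eq0 setIDAC -setIDA setDv setI0.
    apply/eqP/setP=> x; rewrite !inE (place_merge p x pE).
    by case: eqP => [->|]; rewrite ?orbF //= merge_max eqxx.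
  case: pE => tE hE.
  rewrite [p]surjective_pairing; apply/eqP; congr (_, _).
    apply: eq_from_tnth => e; rewrite tnth_mktuple -tE tnth_map /=.
    by rewrite !upM ?place_lgraph ?ffunE // -surjective_pairing.
  by apply/ffunP=> j; rewrite ffunE -hE ffunE upM // place_lgraph ffunE.
case/andP=> dE /eqP UE.
have AE : [set x | place (lgraph (F' (E1, E2)).1 (F' (E1, E2)).2) x == inl ord_max] = E2.
  apply/setP=> x; rewrite inE F'E /place /= ffunE -/(place G).
  have xE : x \in E2 -> place G x = inl i.
    by move=> xE; have /setP/(_ x) := UE; rewrite !inE xE orbT => /esym/eqP.
  case: (boolP (x \in E2)) => [/xE -> |_]; first by rewrite eqxx.
  by case: (place G x) => // v; exact: (emb_neq_max v).
by rewrite /F AE -UE setDUl setDv setU0; move/setDidPl: dE => ->.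
Qed.

Lemma l_cls i j (t : seq (W * W)) (h : {ffun 'I_s -> W}) :
  l_ i j << cls t h >> = << cls ((i, j) :: t) h >>.
Proof. by rewrite l_class_of cls_add_edge. Qed.

Lemma q_cls m (i : V) rho (t : m.-tuple (V * V)) h :
  q_ i rho << cls t h >> = (2 * (rho.-1)`!%:R)^-1 *:
  \sum_(p | merge_lab i p == (t, h)) << cls (nseq rho (emb i, ord_max) ++ p.1) p.2 >>.
Proof.
rewrite /q_ s_cls; congr (_ *: _); elim: rho => [|rho IH] //=.
rewrite IH {1}/l_ raddf_sum; apply: eq_bigr => p _.
by rewrite /= -/(l_ _ _) l_cls.
Qed.

Lemma q_linear (i : V) rho (D : {freeg (vgraph n.+1 s) / rat}) :
  q_ i rho D = \sum_(G <- dom D) coeff G D *: q_ i rho << G >>.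
Proof.
rewrite /q_ /= /s_ fgliftE.
under [RHS]eq_bigr => G _ do rewrite scalerA mulrC -scalerA.
rewrite -scaler_sumr; congr (_ *: _); elim: rho => [|rho IH] /=.
  by apply: eq_bigr => G _; rewrite liftU scale1r.
rewrite IH /l_ raddf_sum; apply: eq_bigr => G _.
exact: fglift_scalable.
Qed.

End Operators.

(** * Invariant functionals of the recursion *)

Definition ev (K : choiceType) (phi : K -> rat) (D : {freeg K / rat}) : rat :=
  fglift (phi : K -> rat^o) D.

Section Ev.

Variables (K : choiceType) (phi : K -> rat).

Lemma evE D : ev phi D = \sum_(x <- dom D) coeff x D * phi x.
Proof. by rewrite /ev fgliftE. Qed.

Lemma evU x : ev phi << x >> = phi x.
Proof. by rewrite /ev liftU scale1r. Qed.

Lemma ev0 : ev phi 0 = 0.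
Proof. exact: (raddf0 (fglift (phi : K -> rat^o))). Qed.

Lemma evZ c D : ev phi (c *: D) = c * ev phi D.
Proof. exact: (fglift_scalable (phi : K -> rat^o)). Qed.

Lemma ev_sum I (r : seq I) P (D : I -> {freeg K / rat}) :
  ev phi (\sum_(i <- r | P i) D i) = \sum_(i <- r | P i) ev phi (D i).
Proof. exact: (raddf_sum (fglift (phi : K -> rat^o))). Qed.

End Ev.

Section Labels.

Variables n s : nat.
Local Notation V := 'I_n.+1.
Local Notation lab m := (m.-tuple (V * V) * {ffun 'I_s -> V})%type.

Definition act_lab m (tau : {perm V}) (p : lab m) : lab m :=
  ([tuple of map (map_pair tau) p.1], [ffun j => tau (p.2 j)]).

Lemma act_labK m tau : cancel (@act_lab m tau) (act_lab tau^-1%g).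
Proof.
case=> t h; congr (_, _); last by apply/ffunP=> j; rewrite !ffunE permK.
apply: eq_from_tnth => e; rewrite !tnth_map.
by case: (tnth t e) => a b; rewrite /map_pair /= !permK.
Qed.

Lemma act_lab_bij m tau : bijective (@act_lab m tau).
Proof.
exists (act_lab tau^-1%g); first exact: act_labK.
by move=> p; rewrite -{2}[p](act_labK tau^-1%g) invgK.
Qed.

Definition vertex_invariant (phi : vgraph n.+1 s -> rat) : Prop :=
  forall m (tau : {perm V}) (p : lab m),
    phi (cls (act_lab tau p).1 (act_lab tau p).2) = phi (cls p.1 p.2).

Definition weight (phi : vgraph n.+1 s -> rat) h (t : seq (V * V)) : rat :=
  if conn_loopless t then phi (cls t h) else 0.

(** For vertex invariant [phi] this is, up to the factor [norm] below, the value
    of [phi] on the sum, over all isomorphism classes of connected loopless graphs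
    with [m] internal edges, of a representative divided by its symmetry factor. *)
Definition numsum m (phi : vgraph n.+1 s -> rat) : rat :=
  \sum_h \sum_(t : m.-tuple (V * V)) weight phi h t.

Lemma edge_invariant_weight phi h : edge_invariant (weight phi h).
Proof.
have [Cp Cf] := edge_invariant_conn_loopless V.
have [Lp Lf] := edge_invariant_cls h.
by split=> [t t' tt'|b x t]; rewrite /weight ?Cf ?Lf // (Cp _ _ tt') (Lp _ _ tt').
Qed.

Lemma weight_act m phi tau (p : lab m) : vertex_invariant phi ->
  weight phi (act_lab tau p).2 (act_lab tau p).1 = weight phi p.2 p.1.
Proof.
move=> inv; rewrite /weight inv; case: p => t h /=.
have iso := isomorphic_cls tau t h.
suff -> : conn_loopless [seq map_pair tau i | i <- t] = conn_loopless t by [].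
rewrite (conn_loopless_cls t h) (conn_loopless_cls [seq _ | i <- t] [ffun j => tau (h j)]).
by rewrite (isomorphic_connected iso) (isomorphic_loopless iso).
Qed.

Definition incident (v : V) (x : V * V) : bool := (x.1 == v) || (x.2 == v).

Lemma sum_incident (t : seq (V * V)) : all (fun e => e.1 != e.2) t ->
  (\sum_v count (incident v) t = 2 * size t)%N.
Proof.
elim: t => [|[a b] t IH] /=; first by rewrite big1.
case/andP=> ab /IH {}IH; rewrite big_split /= IH mulnS; congr (_ + _)%N.
rewrite (bigD1 a) //= (bigD1 b) 1?eq_sym //= /incident /= !eqxx orbT big1 // => v.
by case/andP=> /negbTE va /negbTE vb; rewrite eq_sym va eq_sym vb.
Qed.

(** The weighted sum of the degrees of [v] does not depend on [v], because a
    transposition of the vertices reindexes it, and the degrees of the vertices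
    of a loopless graph add up to twice its number of edges. *)
Lemma sum_weight_incident m phi v : vertex_invariant phi ->
  n.+1%:R * (\sum_h \sum_(t : m.-tuple (V * V)) weight phi h t *+ count (incident v) t)
  = (2 * m)%:R * numsum m phi.
Proof.
move=> inv.
pose S v := \sum_(p : lab m) weight phi p.2 p.1 *+ count (incident v) p.1.
have SE w : \sum_h \sum_(t : m.-tuple (V * V)) weight phi h t *+ count (incident w) t
    = S w by rewrite exchange_big pair_big.
have Sv w : S w = S v.
  rewrite /S [LHS](reindex _ (onW_bij _ (act_lab_bij m (tperm v w)))).
  apply: eq_bigr => p _; rewrite (weight_act (tperm v w) p inv).
  congr (_ *+ _); rewrite /= count_map; apply: eq_count => -[a b] /=.
  by rewrite /incident /= !(canF_eq (tpermK _ _)) tpermR.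
have -> : numsum m phi = \sum_(p : lab m) weight phi p.2 p.1.
  by rewrite /numsum exchange_big pair_big.
rewrite SE mulr_natl.
have -> : S v *+ n.+1 = \sum_w S w.
  by rewrite (eq_bigr (fun=> S v)) // sumr_const card_ord.
rewrite exchange_big mulr_sumr; apply: eq_bigr => -[t h] _ /=.
rewrite sumrMnr /weight; case: ifP => [/andP[lt _]|_]; last by rewrite mul0rn mulr0.
by rewrite sum_incident // size_tuple mulr_natl.
Qed.

End Labels.

Section Pull.

Variables n s : nat.
Local Notation V := 'I_n.+1.
Local Notation W := 'I_n.+2.
Local Notation a i := (emb i, ord_max).
Implicit Type phi : vgraph n.+2 s -> rat.

(** The transpose of [\sum_i q_ i rho]. *)
Definition pull rho phi (G : vgraph n.+1 s) : rat :=
  \sum_(i < n.+1) ev phi (q_ i rho << G >>).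

Lemma ev_pull rho phi D :
  \sum_(i < n.+1) ev phi (q_ i rho D) = ev (pull rho phi) D.
Proof.
rewrite evE /pull; under [RHS]eq_bigr => G _ do rewrite mulr_sumr.
rewrite exchange_big; apply: eq_bigr => i _ /=.
by rewrite q_linear ev_sum; apply: eq_bigr => G _; rewrite evZ.
Qed.

Lemma pull_cls rho phi m (t : m.-tuple (V * V)) h :
  pull rho phi (cls t h) = (2 * (rho.-1)`!%:R)^-1 *
    \sum_i \sum_(p | merge_lab i p == (t, h)) phi (cls (nseq rho (a i) ++ p.1) p.2).
Proof.
rewrite mulr_sumr; apply: eq_bigr => i _; rewrite q_cls evZ ev_sum.
by congr (_ * _); apply: eq_bigr => p _; rewrite evU.
Qed.

(** A permutation of the old vertices, extended to the last vertex as a fixed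
    point, permutes the summands of [pull_cls]. *)
Lemma pull_invariant rho phi : vertex_invariant phi -> vertex_invariant (pull rho phi).
Proof.
move=> inv m tau p; pose tau' : {perm W} := lift_perm ord_max ord_max tau.
have embE j : emb j = lift ord_max j by apply: val_inj; apply: esym (lift_max j).
have tau'max : tau' ord_max = ord_max by rewrite lift_perm_id.
have tau'emb j : tau' (emb j) = emb (tau j) by rewrite !embE lift_perm_lift.
have mergeE i v : merge_last (tau i) (tau' v) = tau (merge_last i v).
  by case: (embP v) => [|j]; rewrite ?tau'max ?merge_max // tau'emb !embK.
rewrite !pull_cls; congr (_ * _); rewrite (reindex_inj (@perm_inj _ tau)).
apply: eq_bigr => i _; rewrite (reindex _ (onW_bij _ (act_lab_bij s m tau'))).
apply: eq_big => [q|q _].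
  rewrite -!surjective_pairing -[RHS](inj_eq (bij_inj (act_lab_bij s m tau))).
  congr (_ == _); rewrite /merge_lab /act_lab; congr (_, _).
    by apply: eq_from_tnth => e; rewrite !tnth_map /map_pair /= !mergeE.
  by apply/ffunP=> j; rewrite !ffunE mergeE.
have := inv _ tau' ([tuple of nseq rho (a i) ++ q.1], q.2).
by rewrite /= map_cat map_nseq /map_pair /= tau'emb tau'max => ->.
Qed.

(** Each numbered graph on the larger vertex set occurs, for given [i], exactly
    once: in the term of the graph into which it merges. *)
Lemma numsum_pull m rho phi : (0 < rho)%N ->
  numsum m (pull rho phi) = (2 * (rho.-1)`!%:R)^-1 *
  \sum_i \sum_h \sum_(t : m.-tuple (W * W) | all (predC (between (a i))) t)
     weight phi h (nseq rho (a i) ++ t).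
Proof.
move=> rho0; rewrite /numsum exchange_big pair_big /=.
under eq_bigr => p _ do rewrite /weight pull_cls.
transitivity (\sum_(p' : m.-tuple (V * V) * {ffun 'I_s -> V})
   \sum_i \sum_(p | merge_lab i p == p') (2 * (rho.-1)`!%:R)^-1 *
    if conn_loopless (merge_lab i p).1 then phi (cls (nseq rho (a i) ++ p.1) p.2) else 0).
  apply: eq_bigr => p' _; rewrite -surjective_pairing; case: ifP => cp.
    rewrite mulr_sumr; apply: eq_bigr => i _; rewrite mulr_sumr.
    by apply: eq_bigr => p /eqP pp'; rewrite pp' cp.
  rewrite big1 // => i _; rewrite big1 // => p /eqP pp'.
  by rewrite pp' cp mulr0.
rewrite exchange_big mulr_sumr; apply: eq_bigr => i _ /=.
transitivity (\sum_(p : m.-tuple (W * W) * {ffun 'I_s -> W})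
    (2 * (rho.-1)`!%:R)^-1 *
    if conn_loopless (merge_lab i p).1 then phi (cls (nseq rho (a i) ++ p.1) p.2) else 0).
  by rewrite [RHS](partition_big (merge_lab i) xpredT).
rewrite -mulr_sumr; congr (_ * _).
under [RHS]eq_bigr => h _ do rewrite big_mkcond.
rewrite [RHS]exchange_big pair_big; apply: eq_bigr => -[t h] _ /=.
rewrite (conn_loopless_merge _ _ rho0) /weight andbC.
by case: (all _ t).
Qed.

(** Otherwise the [m] edges that remain after the merging would connect [n.+1]
    vertices. *)
Lemma weight_nseq_small m rho phi i h (t : m.-tuple (W * W)) :
  (0 < rho)%N -> (m < n)%N -> all (predC (between (a i))) t ->
  weight phi h (nseq rho (a i) ++ t) = 0.
Proof.
move=> rho0 mn ti; rewrite /weight; case: ifP => // ct.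
have := @conn_loopless_size n (map (map_pair (merge_last i)) t).
rewrite (conn_loopless_merge _ _ rho0) ti ct size_map size_tuple => /(_ isT).
by rewrite leqNgt mn.
Qed.

(** The edges at the last vertex are sorted by their other vertex. *)
Lemma sum_between (t : seq (W * W)) : all (fun e => e.1 != e.2) t ->
  (\sum_i count (between (a i)) t = count (incident ord_max) t)%N.
Proof.
elim: t => [|[v w] t IH] /=; first by rewrite big1.
case/andP=> vw /IH {}IH; rewrite big_split /= IH; congr (_ + _)%N.
have sum1 (P : pred V) j : P =1 pred1 j -> (\sum_i (P i : nat) = 1)%N.
  by move=> E; rewrite (bigD1 j) //= E /= eqxx big1 // => i ij; rewrite E /= (negbTE ij).
rewrite /between /incident /=; move: vw.
case: (embP v) => [|j]; case: (embP w) => [|l]; rewrite ?eqxx ?emb_neq_max //= => _.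
- apply: (sum1 _ l) => i.
  by rewrite !xpair_eqE eqxx emb_neq_max andbF /= (inj_eq (@emb_inj n)) eq_sym.
- apply: (sum1 _ j) => i.
  by rewrite !xpair_eqE eqxx emb_neq_max andbT orbF /= (inj_eq (@emb_inj n)) eq_sym.
- by rewrite big1 // => i _; rewrite !xpair_eqE !emb_neq_max andbF.
Qed.

End Pull.

Definition norm n m : rat := (2 ^ m * m`! * n.+1`!)%:R.

Lemma norm_neq0 n m : norm n m != 0.
Proof. by rewrite pnatr_eq0 -lt0n !muln_gt0 expn_gt0 !fact_gt0. Qed.

(** The coefficient with which [pull rho] enters the induction is [rho / 2] times
    the number of ways to place and orient the [rho] parallel edges, up to the
    normalization of the larger graphs; the factor [n.+2] that [norm n m] lacks
    for these comes from averaging over their vertices. *)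
Lemma norm_sub n m rho : (0 < rho <= m)%N ->
  (norm n (m - rho))^-1 * (2 * (rho.-1)`!%:R)^-1 =
  (rho * ('C(m, rho) * 2 ^ rho))%:R / (2 * norm n m).
Proof.
case/andP=> rho0 rm; rewrite /norm.
have -> : (2 ^ m = 2 ^ rho * 2 ^ (m - rho))%N by rewrite -expnD subnKC.
have fE : (rho`! = rho * (rho.-1)`!)%N by case: (rho) rho0.
rewrite -(bin_fact rm) fE; move: (n.+1`!) (fact_gt0 n.+1) => x x0.
rewrite !natrM.
have nz k : (0 < k)%N -> k%:R != 0 :> rat by rewrite pnatr_eq0 -lt0n.
by field; rewrite !nz ?fact_gt0 ?expn_gt0 ?bin_gt0.
Qed.

Lemma ev_theta1 s k (phi : vgraph 1 s -> rat) :
  ev phi (theta 1 k s) = numsum k phi / norm 0 k.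
Proof.
case: k => [|k]; rewrite theta1 /=; last first.
  rewrite ev0 /numsum big1 ?mul0r // => h _; rewrite big1 // => t _.
  rewrite /weight /conn_loopless [t]tuple_eta /=.
  by case: (thead t) => v w; rewrite (ord1 v) (ord1 w).
have [t [h E]] := clsP (class_of (single_vertex s)).
have /isomorphic_card_Eint : isomorphic (single_vertex s) (lgraph (in_tuple t) h).
  have := isomorphic_rep_cls t h; rewrite -E; apply: isomorphic_trans.
  exact/renaming_isomorphic/renaming_rep_class_of.
rewrite card_Eint_lgraph {1}/Eint /= cards0 => /esym/size0nil t0.
rewrite evU E t0 (_ : norm 0 0 = 1) // divr1 /numsum (big_pred1 h) => [|h']; last first.
  by apply/esym/eqP/ffunP=> j; rewrite (ord1 (h j)) (ord1 (h' j)).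
rewrite (big_pred1 [tuple]) => [|u]; last by rewrite [u]tuple0 /= eqxx.
rewrite /weight /conn_loopless /=; case: forallP => // -[] v; apply/forallP=> w.
by rewrite (ord1 v) (ord1 w) connect0.
Qed.

(** The recursion weights each numbered graph by half the degree of its last
    vertex.  On average over the vertices this is the number of edges divided by
    the number of vertices: the former cancels the prefactor of the recursion,
    the latter completes the factorial in [norm]. *)
Lemma ev_theta s n k (phi : vgraph n.+1 s -> rat) : vertex_invariant phi ->
  ev phi (theta n.+1 k s) = numsum (k + n) phi / norm n (k + n).
Proof.
elim: n k phi => [|n IH] k phi inv; first by rewrite addn0 ev_theta1.
set m := (k + n.+1)%N.
have m0 : m%:R != 0 :> rat by rewrite pnatr_eq0 /m addnS.
rewrite theta_rec // evZ ev_sum.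
pose a i := (@emb n i, @ord_max n.+1).
pose J rho i h := \sum_(t : (m - rho).-tuple ('I_n.+2 * 'I_n.+2) |
    all (predC (between (a i))) t) weight phi h (nseq rho (a i) ++ t).
have -> : \sum_(1 <= rho < k.+2)
      ev phi (\sum_(i < n.+1) q_ i rho (theta n.+1 (k.+1 - rho) s)) =
    (2 * norm n m)^-1 * \sum_(1 <= rho < k.+2) \sum_i \sum_h
      J rho i h *+ (rho * ('C(m, rho) * 2 ^ rho)).
  rewrite mulr_sumr; apply: eq_big_nat => rho /andP[rho0 rk].
  rewrite ev_sum ev_pull IH; last exact: pull_invariant.
  have -> : (k.+1 - rho + n = m - rho)%N by rewrite /m; lia.
  rewrite numsum_pull // mulrC mulrA norm_sub; last by rewrite rho0 /m; lia.
  rewrite mulrAC mulrC mulrA [_^-1 * _]mulrC -mulrA [RHS]mulrC mulr_natl.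
  congr (_ * _); rewrite mulr_natl -sumrMnl; apply: eq_bigr => i _.
  by rewrite -sumrMnl.
(* For [rho > k + 1] too few edges remain to connect the merged graph, so [rho]
   may range over all possible multiplicities. *)
have -> : \sum_(1 <= rho < k.+2) \sum_i \sum_h J rho i h *+ (rho * ('C(m, rho) * 2 ^ rho))
  = \sum_(1 <= rho < m.+1) \sum_i \sum_h J rho i h *+ (rho * ('C(m, rho) * 2 ^ rho)).
  rewrite [RHS](big_cat_nat (n := k.+2)) //=; last by rewrite /m; lia.
  rewrite [X in _ = _ + X]big_nat_cond [X in _ = _ + X]big1 ?addr0 //.
  move=> rho /andP[/andP[krho rhom] _]; rewrite big1 // => i _; rewrite big1 // => h _.
  rewrite /J big1 ?mul0rn // => t tP; apply: weight_nseq_small tP; move: rhom; rewrite /m; lia.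
rewrite exchange_big /=.
under eq_bigr => i _ do rewrite exchange_big /=.
have -> : \sum_(i < n.+1) \sum_h \sum_(1 <= rho < m.+1)
      J rho i h *+ (rho * ('C(m, rho) * 2 ^ rho)) =
    \sum_h \sum_(t : m.-tuple ('I_n.+2 * 'I_n.+2))
      weight phi h t *+ count (incident ord_max) t.
  rewrite exchange_big; apply: eq_bigr => h _ /=.
  transitivity (\sum_(i < n.+1) \sum_(t : m.-tuple ('I_n.+2 * 'I_n.+2))
      weight phi h t *+ count (between (a i)) t).
    apply: eq_bigr => i _; rewrite sum_count_between_weighted //.
      by rewrite /a /= emb_neq_max.
    exact: edge_invariant_weight.
  rewrite exchange_big; apply: eq_bigr => t _ /=; rewrite sumrMnr /weight.
  by case: ifP => [/andP[lt _]|_]; rewrite ?mul0rn // sum_between.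
have := sum_weight_incident m ord_max inv; set D := \sum_h _.
have D0 : n.+2%:R != 0 :> rat by rewrite pnatr_eq0.
move=> /(canRL (mulKf D0)) ->.
have -> : norm n.+1 m = norm n m * n.+2%:R by rewrite /norm factS mulnA mulnAC natrM.
rewrite natrM -/m.
move: (norm n m) (m%:R) (n.+2%:R) (norm_neq0 n m) m0 D0 => N x y N0 x0 y0.
by field; rewrite N0 x0 y0.
Qed.

(** * Positivity and support *)

Lemma sumr_gt0 (I : eqType) (R : numDomainType) (r : seq I) (P : pred I) (F : I -> R) j :
  (forall i, i \in r -> P i -> 0 <= F i) -> j \in r -> P j -> 0 < F j ->
  0 < \sum_(i <- r | P i) F i.
Proof.
move=> F0 jr Pj Fj; rewrite (big_rem j) //= Pj ltr_wpDr // big_seq_cond.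
by rewrite sumr_ge0 // => i /andP[/mem_rem ir Pi]; apply: F0.
Qed.

Section Support.

Variable s : nat.

Lemma coeff_q_ge0 n i rho (G : vgraph n.+2 s) (H : vgraph n.+1 s) :
  0 <= coeff G (q_ i rho << H >>).
Proof.
have [t [h ->]] := clsP H.
rewrite (q_cls i rho (in_tuple t)) coeffZ mulr_ge0 ?invr_ge0 ?mulr_ge0 ?ler0n //.
by rewrite raddf_sum sumr_ge0 // => p _; rewrite /= coeffU mul1r ler0n.
Qed.

(** Splitting a vertex of a connected loopless graph and joining the two halves by
    [rho] edges keeps it connected and loopless, and adds [rho] edges and one
    vertex. *)
Lemma coeff_q_eq0 n k i rho (G : vgraph n.+2 s) (H : vgraph n.+1 s) :
  (0 < rho < k.+2)%N -> H \in V_loopless n.+1 (k.+1 - rho) s ->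
  G \notin V_loopless n.+2 k s -> coeff G (q_ i rho << H >>) = 0.
Proof.
case/andP=> rho0 rhok; have [t [h ->]] := clsP H.
rewrite cls_V_loopless => /andP[/eqP tm ct] GN.
rewrite (q_cls i rho (in_tuple t)) coeffZ raddf_sum big1 ?mulr0 // => p /eqP pt.
rewrite /= coeffU; case: eqP => [GE|_]; last by rewrite mulr0.
move: GN; rewrite -GE cls_V_loopless size_cat size_nseq size_tuple.
have /(congr1 (fun p => val p.1)) /= pt1 := pt.
have : conn_loopless (map (map_pair (merge_last i)) p.1) by rewrite pt1.
rewrite (conn_loopless_merge _ _ rho0) => /andP[-> _].
by rewrite andbT => /eqP[]; move: tm; lia.
Qed.

(** [H] is obtained from [G] by merging the last vertex into a neighbour [i], and
    [rho] is the number of edges between the two. *)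
Lemma coeff_q_gt0 n k (G : vgraph n.+2 s) : G \in V_loopless n.+2 k s ->
  exists i rho H, [/\ (0 < rho < k.+2)%N, H \in V_loopless n.+1 (k.+1 - rho) s
    & 0 < coeff G (q_ i rho << H >>)].
Proof.
have [u [h ->]] := clsP G; rewrite cls_V_loopless => /andP[/eqP um cu].
have [i iu] := conn_loopless_neighbour cu.
have [t tN [bs bsu pu]] := split_parallel (emb i, ord_max) u.
have rho0 : (0 < size bs)%N by rewrite bsu -has_count.
have ct : conn_loopless (map (map_pair (merge_last i)) t).
  rewrite (conn_loopless_merge _ _ rho0) tN andbT.
  have inv := edge_invariant_conn_loopless 'I_n.+2.
  by rewrite -edge_invariant_flips // -(inv.1 _ _ pu).
have tn : (n <= size t)%N by have := conn_loopless_size ct; rewrite size_map.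
have usz : (size bs + size t = k + n.+1)%N.
  by rewrite -um (perm_size pu) size_cat size_map.
pose h' : {ffun 'I_s -> 'I_n.+1} := [ffun j => merge_last i (h j)].
exists i, (size bs), (cls (map (map_pair (merge_last i)) t) h'); split.
- by rewrite rho0; lia.
- have tm : size t = (k.+1 - size bs + n)%N by lia.
  by rewrite cls_V_loopless ct andbT size_map; apply/eqP.
rewrite (q_cls i _ [tuple of map (map_pair (merge_last i)) (in_tuple t)]).
rewrite coeffZ mulr_gt0 ?invr_gt0 ?mulr_gt0 ?ltr0n ?fact_gt0 // raddf_sum.
have GE : cls u h = cls (nseq (size bs) (emb i, ord_max) ++ t) h.
  by rewrite (cls_perm _ pu) (edge_invariant_flips _ _ _ (edge_invariant_cls h)).
apply: (@sumr_gt0 _ _ _ _ _ (in_tuple t, h)) => [p _ _|||] /=.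
- by rewrite coeffU mul1r ler0n.
- exact: mem_index_enum.
- exact: eqxx.
- by rewrite coeffU GE eqxx mulr1.
Qed.

(** Nothing cancels in the recursion, since all the coefficients are nonnegative;
    so a single positive contribution suffices. *)
Lemma coeff_theta n k (G : vgraph n.+1 s) :
  (G \in V_loopless n.+1 k s -> 0 < coeff G (theta n.+1 k s)) /\
  (G \notin V_loopless n.+1 k s -> coeff G (theta n.+1 k s) = 0).
Proof.
elim: n k G => [|n IH] k G.
  have -> : coeff G (theta 1 k s) = numsum k (fun H => (H == G)%:R) / norm 0 k.
    exact: ev_theta1.
  have [t [h ->]] := clsP G; rewrite cls_V_loopless addn0; split.
    case/andP=> /eqP tk ct; rewrite divr_gt0 ?ltr0n ?muln_gt0 ?expn_gt0 ?fact_gt0 //.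
    have w0 h1 t1 : 0 <= weight (fun H => (H == cls t h)%:R) h1 t1.
      by rewrite /weight; case: ifP; rewrite ?ler0n.
    apply: (@sumr_gt0 _ _ _ _ _ h) => [h' _ _|||]; rewrite ?sumr_ge0 ?mem_index_enum //.
    apply: (@sumr_gt0 _ _ _ _ _ (tcast tk (in_tuple t))) => [t' _ _|||];
      rewrite ?w0 ?mem_index_enum //.
    by rewrite /weight val_tcast ct eqxx.
  move=> tk; rewrite /numsum big1 ?mul0r // => h' _; rewrite big1 // => t' _.
  rewrite /weight; case: ifP => // ct'; case: eqP => // E.
  have := cls_V_loopless k t' h'; rewrite E cls_V_loopless addn0 size_tuple eqxx ct'.
  by rewrite (negbTE tk).
have IH0 k' H : 0 <= coeff H (theta n.+1 k' s).
  have [pos zero] := IH k' H.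
  by case: (boolP (H \in V_loopless n.+1 k' s)) => [/pos/ltW|/zero->].
have coeff_q i rho D : coeff G (q_ i rho D) =
    \sum_(H <- dom D) coeff H D * coeff G (q_ i rho << H >>).
  by rewrite q_linear raddf_sum; apply: eq_bigr => H _; rewrite /= coeffZ.
have term0 rho i : 0 <= coeff G (q_ i rho (theta n.+1 (k.+1 - rho) s)).
  by rewrite coeff_q sumr_ge0 // => H _; apply: mulr_ge0 (IH0 _ _) (coeff_q_ge0 _ _ _ _).
rewrite theta_rec // coeffZ raddf_sum; split=> [GV|GN].
  rewrite mulr_gt0 ?invr_gt0 ?ltr0n ?addnS //.
  have [i [rho [H [rhok HV HG]]]] := coeff_q_gt0 GV.
  apply: (@sumr_gt0 _ _ _ _ _ rho) => [r _ _|||] //=.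
  - by rewrite raddf_sum sumr_ge0 // => j _; apply: term0.
  - by rewrite mem_index_iota.
  rewrite raddf_sum (@sumr_gt0 _ _ _ _ _ i) ?mem_index_enum //=.
  rewrite coeff_q.
  have Hpos := (IH _ _).1 HV.
  apply: (@sumr_gt0 _ _ _ _ _ H) => [H' _ _|||] //.
  - exact: mulr_ge0 (IH0 _ _) (coeff_q_ge0 _ _ _ _).
  - by rewrite mem_dom gt_eqF.
  - by rewrite mulr_gt0.
rewrite big_nat_cond big1 ?mulr0 // => rho /andP[rhok _] /=.
rewrite raddf_sum big1 // => i _ /=; rewrite coeff_q big1 // => H _.
case: (boolP (H \in V_loopless n.+1 (k.+1 - rho) s)) => [HV|/((IH _ _).2)->].
  by rewrite (coeff_q_eq0 i rhok HV GN) mulr0.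
by rewrite mul0r.
Qed.

End Support.

(** * Sums over isomorphism classes *)

Theorem theorem18 (s n k : nat) (n_gt0 : (0 < n)%N) :
  (forall G : vgraph n s, G \in V_loopless n k s -> 0 < coeff G (theta n k s)) /\
  (forall G : vgraph n s, G \notin V_loopless n k s -> coeff G (theta n k s) = 0) /\
  (forall C : {pred vgraph n s},
     iso_class C -> {subset C <= V_loopless n k s} ->
     forall G0 : vgraph n s, G0 \in C ->
       \sum_(G <- dom (theta n k s) | G \in C) coeff G (theta n k s)
         = (symfactor G0)%:R^-1).
Proof.
case: n n_gt0 => // n _.
split=> [G|]; first exact: (coeff_theta k G).1.
split=> [G|C [G CE] CV G0 G0C]; first exact: (coeff_theta k G).2.
have CE0 H : (H \in C) = isomorphic (rep G0) (rep H).
  rewrite CE; rewrite CE in G0C.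
  by apply/idP/idP; apply: isomorphic_trans; rewrite // isomorphic_sym.
have [t [h G0E]] := clsP G0.
have /andP[/eqP tm ct] : (size t == k + n)%N && conn_loopless t.
  by rewrite -(cls_V_loopless k t h) -G0E CV.
pose m := (k + n)%N; have tmP : size t == m by rewrite tm.
pose t0 : m.-tuple _ := Tuple tmP.
have iso0 : isomorphic (rep G0) (lgraph t0 h).
  rewrite G0E (cls_tuple t0 h : cls t h = _).
  exact/renaming_isomorphic/renaming_symm/renaming_rep_class_of.
(* The class sum is the value of the indicator function of the class. *)
pose phi (H : vgraph n.+1 s) : rat := (H \in C)%:R.
have -> : \sum_(G <- dom (theta n.+1 k s) | G \in C) coeff G (theta n.+1 k s) =
    ev phi (theta n.+1 k s).
  rewrite evE big_mkcond; apply: eq_bigr => H _.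
  by rewrite /phi; case: (H \in C); rewrite ?mulr1 ?mulr0.
have phi_inv : vertex_invariant phi.
  move=> m' tau p; congr (_%:R); congr nat_of_bool; rewrite !CE0.
  have iso := isomorphic_cls tau p.1 p.2.
  by apply/idP/idP => H; apply: isomorphic_trans H _; rewrite // isomorphic_sym.
rewrite ev_theta // -/m.
have -> : numsum m phi =
    #|[set p : m.-tuple ('I_n.+1 * 'I_n.+1) * {ffun 'I_s -> 'I_n.+1} |
        isomorphic (lgraph p.1 p.2) (lgraph t0 h)]|%:R.
  rewrite /numsum exchange_big pair_big -sum1dep_card natr_sum [RHS]big_mkcond.
  apply: eq_bigr => p _ /=; rewrite /weight /phi.
  have -> : isomorphic (lgraph p.1 p.2) (lgraph t0 h) = (cls p.1 p.2 \in C).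
    rewrite CE0 cls_tuple.
    have isop := renaming_isomorphic (renaming_rep_class_of (lgraph p.1 p.2)).
    apply/idP/idP => iso.
      apply: isomorphic_trans iso0 (isomorphic_trans _ isop).
      exact: isomorphic_sym.
    apply: isomorphic_trans isop (isomorphic_trans _ iso0).
    exact: isomorphic_sym.
  case pC : (_ \in C); last by case: ifP.
  by have := CV _ pC; rewrite cls_V_loopless => /andP[_ ->].
have S0 : symfactor G0 = symmetry_factor (lgraph t0 h).
  by rewrite /symfactor !symmetry_factorE; apply: card_isos.
have S_neq0 : (symfactor G0)%:R != 0 :> rat.
  have : (0 < n.+1`! * m`! * 2 ^ m)%N by rewrite !muln_gt0 !fact_gt0 expn_gt0.
  by rewrite -(card_numberings t0 h) -S0 muln_gt0 pnatr_eq0 -lt0n => /andP[].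
apply: (mulIf S_neq0); rewrite mulVf // mulrAC -natrM S0 card_numberings.
rewrite /norm mulnC mulnA mulnAC divff // pnatr_eq0 -lt0n.
by rewrite !muln_gt0 expn_gt0 !fact_gt0.
Qed.
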